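(* Let $k\in\mathbb{N}$ and let $H:\mathbb{R}_{\ge 0}^k\to\mathbb{R}$ be a function such that $$\int_{B(0,1)}\Big|H\big(|c_1(\alpha)|,\dots,|c_k(\alpha)|\big)\Big|^2\,d\mu<\infty,$$ and let $(a_n,b_n)_{n=1}^\infty$ be a Stoltz sequence of pairs of natural numbers. Then $$\lim_{n\to\infty}\frac{1}{b_n}\sum_{j=1}^{b_n}H\big(|c_{a_n+j}(\alpha)|,\dots,|c_{a_n+j+k-1}(\alpha)|\big)=\sum_{(i_1,\dots,i_k)\in\mathbb{N}^k}H\left(p^{\frac{i_1}{e}},\dots,p^{\frac{i_k}{e}}\right)\frac{(p^f-1)^k}{p^{f(i_1+\cdots+i_k)}}$$ for $\mu$-almost every $\alpha\in B(0,1)$.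
   Context: $\mathbb{N}$ denotes the positive integers. Let $p$ be a prime and let $K$ be a finite extension of $\mathbb{Q}_p$ of degree $m$, with ramification index $e$ and residue degree $f$ (so $m=ef$). Let $|\cdot|$ be the unique extension to $K$ of the $p$-adic absolute value with $|p|=p^{-1}$. Let $L\subseteq K$ be the unramified subextension of degree $f$ over $\mathbb{Q}_p$, write $L=\mathbb{Q}_p(\gamma)$ with $\gamma$ a primitive $(p^f-1)$-th root of unity, and fix $\beta\in K$ with $K=L(\beta)$ and $|\beta|=p^{1/e}$. For $b=\sum_{j\ge n_0}a_jp^j\in\mathbb{Q}_p$ with digits $a_j\in\{0,1,\dots,p-1\}$ put $\lfloor b\rfloor_p=\sum_{n_0\le j\le 0}a_jp^j$ (which is $0$ if $|b|<1$). Every $\alpha\in K$ is uniquely $\alpha=\sum_{i=0}^{e-1}\sum_{j=0}^{f-1}b_{i,j}\gamma^j\beta^i$ with $b_{i,j}\in\mathbb{Q}_p$, and $\lfloor\alpha\rfloor=\sum_{i=0}^{e-1}\sum_{j=0}^{f-1}\lfloor b_{i,j}\rfloor_p\gamma^j\beta^i$. Let $B(0,1)=\{x\in K:|x|<1\}$, and let $\mu$ be the restriction to $B(0,1)$ (with its Borel $\sigma$-algebra) of the Haar measure of the additive group $K$, normalized by $\mu(B(0,1))=1$. The continued fraction map $T:B(0,1)\to B(0,1)$ is $T(\alpha)=\frac1\alpha-\left\lfloor\frac1\alpha\right\rfloor$ for $\alpha\ne 0$ and $T(0)=0$. The $n$-th partial quotient of $\alpha\in B(0,1)$ is $c_n(\alpha)=\lfloor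 1/T^{n-1}(\alpha)\rfloor$ for $n\ge 1$, defined when $T^{n-1}(\alpha)\neq 0$ (so all $c_n(\alpha)$ are defined for $\mu$-almost every $\alpha$). Stoltz sequences: for an infinite set $\Omega\subseteq\mathbb{Z}\times\mathbb{N}$, $h\ge 0$, a real $\kappa>0$ and a positive integer $\lambda$, define $\Omega^h=\{(n,k)\in\Omega:k\ge h\}$, $\Omega^h_\kappa=\{(z,s)\in\mathbb{Z}^2:|z-y|<\kappa(s-r)\text{ for some }(y,r)\in\Omega^h\}$, and $\Omega^h_\kappa(\lambda)=\{n:(n,\lambda)\in\Omega^h_\kappa\}$. A sequence of pairs of natural numbers $(a_n,b_n)_{n\ge 1}$ is Stoltz if there exist such an $\Omega$ and a function $h=h(t)$ tending to infinity with $t$ such that $(a_n,b_n)\in\Omega^{h(t)}$ for all $n\ge t$, and there exist $l$, $\kappa>0$ and $A_\kappa>0$ such that $\#\Omega^l_\kappa(\lambda)\le A_\kappa\lambda$ for all positive integers $\lambda$. *)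

(* Defs.v *)
From HB Require Import structures.
From mathcomp Require Import all_boot all_order all_algebra all_field.
From mathcomp Require Import finmap.
From mathcomp Require Import all_classical all_reals all_analysis.

Set Implicit Arguments.
Unset Strict Implicit.
Unset Printing Implicit Defensive.

Import Order.TTheory GRing.Theory Num.Theory.
Import numFieldNormedType.Exports.

Local Open Scope classical_set_scope.
Local Open Scope ring_scope.

Record absolute_value (R : realType) (F : fieldType) (abs : F -> R) : Prop := {
  absv_ge0 : forall x, 0 <= abs x;
  absv_eq0 : forall x, abs x = 0 <-> x = 0;
  absvM : forall x y, abs (x * y) = abs x * abs y;
  absvD : forall x y, abs (x + y) <= abs x + abs y
}.

(** The p-adic absolute value on the rationals, normalized by |p| = 1/p. *)
Definition rat_padic_abs (R : realType) (p : nat) (q : rat) : R :=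
  if q == 0 then 0
  else p%:R ^ ((logn p `|denq q|%N)%:Z - (logn p `|numq q|%N)%:Z).

(** [(Qp, absp)] is the completion of the rationals for the p-adic absolute
    value; this determines it up to a unique isometric isomorphism. *)
Record is_padic_field (R : realType) (p : nat) (Qp : fieldType)
    (absp : Qp -> R) : Prop := {
  padic_absv : absolute_value absp;
  padic_abs_rat : forall q : rat, absp (ratr q) = rat_padic_abs R p q;
  padic_dense : forall (x : Qp) (eps : R), 0 < eps ->
    exists q : rat, absp (x - ratr q) < eps;
  padic_complete : forall u : nat -> Qp,
    (forall eps : R, 0 < eps -> exists N : nat, forall m n : nat,
       (N <= m)%N -> (N <= n)%N -> absp (u m - u n) < eps) ->
    exists l : Qp, (fun n => absp (u n - l)) @ \oo --> (0 : R)
}.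

(** e is the index of the value group of [Qp] in that of the subspace (in
    practice, subfield) [E]: the [x i] represent the cosets. *)
Definition ramification_index (R : realType) (Qp : fieldType) (absp : Qp -> R)
    (K : fieldExtType Qp) (absK : K -> R) (E : {vspace K}) (e : nat) : Prop :=
  exists x : 'I_e -> K,
    (forall i, x i \in E /\ x i != 0) /\
    (forall y : K, y \in E -> y != 0 ->
       exists! i : 'I_e, exists q : Qp, absK y = absp q * absK (x i)).

(** f is the degree of the residue field extension: the residue classes of
    the [u i] form a basis of the residue field of [E] over that of [Qp]. *)
Definition residue_degree (R : realType) (Qp : fieldType) (absp : Qp -> R)
    (K : fieldExtType Qp) (absK : K -> R) (E : {vspace K}) (f : nat) : Prop :=
  exists u : 'I_f -> K,
    [/\ forall i, u i \in E /\ absK (u i) <= 1,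
        forall x : K, x \in E -> absK x <= 1 ->
          exists a : 'I_f -> Qp, (forall i, absp (a i) <= 1) /\
            absK (x - \sum_(i < f) a i *: u i) < 1 &
        forall a : 'I_f -> Qp, (forall i, absp (a i) <= 1) ->
          absK (\sum_(i < f) a i *: u i) < 1 -> forall i, absp (a i) < 1].

(** The separability of the residue extension is automatic, the residue field
    of [Qp] being finite. *)
Definition unramified (R : realType) (Qp : fieldType) (absp : Qp -> R)
    (K : fieldExtType Qp) (absK : K -> R) (E : {vspace K}) : Prop :=
  ramification_index absp absK E 1.

(** x = sum over j >= -M of a_j p^j, the digit a_j being stored as
    [a (M + j)].  Padding by zero digits, every expansion starts at some -M. *)
Definition padic_expansion (R : realType) (p : nat) (Qp : fieldType)
    (absp : Qp -> R) (x : Qp) (M : nat) (a : nat -> nat) : Prop :=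
  (forall i, (a i < p)%N) /\
  (fun N : nat => absp (x - \sum_(0 <= i < N) (a i)%:R * p%:R ^+ i / p%:R ^+ M))
    @ \oo --> (0 : R).

(** The terms of index i <= M are those of exponent j = i - M <= 0. *)
Definition padic_floor (R : realType) (p : nat) (Qp : fieldType)
    (absp : Qp -> R) (x : Qp) : Qp :=
  xget 0 [set y | exists (M : nat) (a : nat -> nat),
    padic_expansion p absp x M a /\
    y = \sum_(0 <= i < M.+1) (a i)%:R * p%:R ^+ i / p%:R ^+ M].

Section ContinuedFraction.
Variables (R : realType) (p : nat) (Qp : fieldType) (absp : Qp -> R).
Variables (K : fieldExtType Qp) (e f : nat) (gamma beta : K).

Definition comb (b : 'I_e -> 'I_f -> Qp) : K :=
  \sum_(i < e) \sum_(j < f) b i j *: (gamma ^+ j * beta ^+ i).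

(** The coordinates of [x]: unique when the gamma^j beta^i form a basis. *)
Definition coords (x : K) : 'I_e -> 'I_f -> Qp :=
  xget (fun _ _ => 0) [set b | x = comb b].

Definition cf_floor (x : K) : K :=
  comb (fun i j => padic_floor p absp (coords x i j)).

Definition cf_map (x : K) : K := if x == 0 then 0 else x^-1 - cf_floor x^-1.

(** Meaningful for n >= 1 and [iter n.-1 cf_map x != 0] only; otherwise, as
    0^-1 = 0, it takes a junk value. *)
Definition partial_quotient (n : nat) (x : K) : K :=
  cf_floor (iter n.-1 cf_map x)^-1.

End ContinuedFraction.

(** [K] with the metric topology defined by [absK]. *)
Definition abs_space (R : realType) (K : fieldType) (absK : K -> R) : Type := K.

Section AbsSpace.
Variables (R : realType) (K : fieldType) (absK : K -> R).

HB.instance Definition _ := Choice.copy (abs_space absK) K.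
HB.instance Definition _ := isPointed.Build (abs_space absK) (0 : K).

Definition abs_ball (c : K) (r : R) : set (abs_space absK) :=
  [set x : K | absK (x - c) < r].

Definition abs_open (A : set (abs_space absK)) : Prop :=
  forall x, A x -> exists2 r : R, 0 < r & abs_ball x r `<=` A.

Lemma abs_openT : abs_open setT.
Proof. by move=> x _; exists 1. Qed.

Lemma abs_openI : setI_closed abs_open.
Proof.
move=> A B oA oB x [Ax Bx].
have [r r0 rA] := oA _ Ax; have [s s0 sB] := oB _ Bx.
exists (Num.min r s); first by rewrite lt_min r0.
by move=> y; rewrite /abs_ball/= lt_min => /andP[yr ys]; split;
  [exact: rA | exact: sB].
Qed.

Lemma abs_open_bigcup (I : Type) (F : I -> set (abs_space absK)) :
  (forall i, abs_open (F i)) -> abs_open (\bigcup_i F i).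
Proof.
move=> oF x [i _ Fix]; have [r r0 rF] := oF i _ Fix.
by exists r => // y yr; exists i => //; exact: rF.
Qed.

HB.instance Definition _ := isOpenTopological.Build (abs_space absK)
  abs_openT abs_openI abs_open_bigcup.

End AbsSpace.

(** [K] with its Borel sigma-algebra. *)
Notation borel_space absK := (g_sigma_algebraType (@open (abs_space absK))).

(** A Haar measure of the additive group of [K]; regularity is automatic when
    [K] is locally compact and second countable. *)
Record haar_measure (R : realType) (K : fieldType) (absK : K -> R)
    (mu : {measure set (borel_space absK) -> \bar R}) : Prop := {
  haar_translation : forall (x : K) (A : set (borel_space absK)),
    measurable A -> mu [set (x + y : K) | y in (A : set K)] = mu A;
  haar_compact : forall A : set (abs_space absK), compact A -> (mu A < +oo)%E;
  haar_open : forall A : set (abs_space absK),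
    open A -> A !=set0 -> (0 < mu A)%E
}.

Definition unit_ball (R : realType) (K : fieldType) (absK : K -> R) :
    set (borel_space absK) :=
  [set x : K | absK x < 1].
Arguments unit_ball {R K} absK _.

Section Stoltz.
Variable R : realType.

Definition stoltz_level (Omega : set (int * nat)) (h : R) : set (int * nat) :=
  [set w | Omega w /\ h <= w.2%:R].

Definition stoltz_cone (Omega : set (int * nat)) (h kappa : R) :
    set (int * int) :=
  [set z | exists2 w : int * nat, stoltz_level Omega h w &
     `|(z.1 - w.1)%:~R| < kappa * (z.2 - w.2%:Z)%:~R].

Definition stoltz_slice (Omega : set (int * nat)) (h kappa : R)
    (lambda : nat) : set int :=
  [set n | stoltz_cone Omega h kappa (n, lambda%:Z)].

(** Sequences are indexed by n >= 1: the terms of index 0 are irrelevant. *)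
Definition stoltz (a b : nat -> nat) : Prop :=
  exists (Omega : set (int * nat)),
    [/\ infinite_set Omega,
        forall w, Omega w -> (0 < w.2)%N,
        exists h : nat -> R,
          [/\ forall t, 0 <= h t,
              h @ \oo --> +oo &
              forall t n : nat, (0 < t)%N -> (t <= n)%N ->
                stoltz_level Omega (h t) ((a n)%:Z, b n)] &
        exists l kappa A : R,
          [/\ 0 <= l, 0 < kappa, 0 < A &
              forall lambda : nat, (0 < lambda)%N ->
                finite_set (stoltz_slice Omega l kappa lambda) /\
                (#|` fset_set (stoltz_slice Omega l kappa lambda)|)%fset%:R
                  <= A * lambda%:R]].

End Stoltz.

(** The sum over [D] of an absolutely summable real family, as the difference
    of the sums of its positive and negative parts. *)
Definition real_sum (R : realType) (T : choiceType) (D : set T) (F : T -> R) :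
    R :=
  fine (\esum_(i in D) ((EFin \o F)^\+ i) - \esum_(i in D) ((EFin \o F)^\- i))%E.

(* Main.v *)
(** Let rho = p^(1/e), q = p^f.  The gamma^j beta^i are orthogonal for the
    absolute value, so the floor picks one point in each coset of B(0,1), and
    for |c| = rho^i with c a floor, x |-> 1/(c + x) maps each ball in B(0,1) to a
    ball smaller by the factor rho^(-2i).  Hence the set where the first
    partial quotients take given values is a ball, whose measure is a product: the
    partial quotients are i.i.d., and |c_n| = rho^i with probability
    (q - 1) / q^i.

    For the moving averages, H may be assumed nonnegative.  The summands are
    k-dependent, so a sum over m consecutive indices has variance O(m).  Cut the
    indices into blocks of length 8^s.  By the cone condition, the windows
    (a_n, a_n + b_n] with 16^s <= b_n < 16^(s+1) meet O(2^s) of these blocks, and the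
    mean square errors of the block averages, O(8^(-s)) each, are summable
    over all these blocks and all s.  So almost surely the block averages
    converge uniformly, and nonnegativity carries this over to the windows. *)

Require Import Defs.
From HB Require Import structures.
From mathcomp Require Import all_boot all_order all_algebra all_field.
From mathcomp Require Import ring lra zify.
From mathcomp Require Import finmap.
From mathcomp Require Import all_classical all_reals all_analysis.
From mathcomp Require Import measurable_realfun.

Set Implicit Arguments.
Unset Strict Implicit.
Unset Printing Implicit Defensive.

Import Order.TTheory GRing.Theory Num.Theory.
Import numFieldNormedType.Exports.

Local Open Scope classical_set_scope.
Local Open Scope ring_scope.

(** * Absolute values *)

(** The residue representatives and value-group representatives behind [e] and [f] are unspecified,
    whereas gamma is known only by its order and beta only by its absolute value. Pigeonhole closes
    the gap: the digit combinations of powers of gamma are as many as the residue classes, the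
    powers of beta as many as the cosets of the value group.

    The measure theory sees the floor only through |x - fl x| < 1, constancy on cosets of the open
    unit ball and countability of its range. Orbits that reach 0 produce digits outside the
    branches; they are confined to cylinders with at most one point.

    A Stoltz sequence may have b_n growing as slowly as one likes, so the mean square errors of the
    windows need not be summable over n; hence the passage to finitely many blocks per scale. With
    blocks of length m at scale 16^s, their number times the variance of one average is of order
    (16^s / m) / m, while the two incomplete blocks at the ends of a window weigh m / 16^s. The
    first wants m well above 4^s, the second well below 16^s, and 8^s is the geometric mean. *)

Lemma bernoulli_ineq (R : realDomainType) (x : R) (n : nat) :
  0 <= x -> 1 + x *+ n <= (1 + x) ^+ n.
Proof.
move=> x0; elim: n => [|n ih]; first by rewrite mulr0n addr0 expr0.
rewrite exprS mulrS.
apply: (le_trans (y := (1 + x) * (1 + x *+ n))).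
  have := mulrn_wge0 n x0; have := mulr_ge0 x0 (mulrn_wge0 n x0).
  by lra.
by apply: ler_wpM2l => //; lra.
Qed.

Lemma exprn_unbounded (R : realType) (t C : R) : 1 < t -> exists n : nat, C < t ^+ n.
Proof.
move=> t1; have d0 : 0 < t - 1 by rewrite subr_gt0.
exists (Num.truncn (C / (t - 1))).+1.
have := bernoulli_ineq (Num.truncn (C / (t - 1))).+1 (ltW d0); rewrite subrKC.
apply: lt_le_trans; rewrite -mulr_natl -[ltLHS]add0r ler_ltD//.
by rewrite -ltr_pdivrMr// truncnS_gt.
Qed.

(* Squaring Bernoulli's inequality makes t^(2n) grow at least quadratically. *)
Lemma exprn_le_linear (R : realType) (t : R) :
  0 <= t -> (forall n : nat, t ^+ n <= n.+1%:R) -> t <= 1.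
Proof.
move=> t0 tn; rewrite leNgt; apply/negP => t1.
set d := t - 1.
have d0 : 0 < d by rewrite /d; lra.
have d2 : 0 < d ^+ 2 by rewrite exprn_gt0.
pose n := (Num.truncn (3%:R / d ^+ 2)).+1.
have nd : 3%:R < n%:R * d ^+ 2.
  rewrite -ltr_pdivrMr //; exact: truncnS_gt.
have := tn (n * 2)%N; rewrite exprM => h.
have b : (d *+ n) ^+ 2 <= (t ^+ n) ^+ 2.
  have := bernoulli_ineq n (ltW d0).
  have -> : 1 + d = t by rewrite /d; lra.
  move=> b; have dn := mulrn_wge0 n (ltW d0).
  by rewrite lerXn2r ?nnegrE //; lra.
have {}h := le_trans b h.
move: h; rewrite -(mulr_natl d) -(natr1 (n * 2)) natrM => h.
have n1 : (1 : R) <= n%:R by rewrite ler1n.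
have : n%:R * (n%:R * d ^+ 2) <= n%:R * 3%:R :> R by nra.
rewrite ler_pM2l; lra.
Qed.

Section AbsoluteValue.
Variables (R : realType) (F : fieldType) (abs : F -> R).
Hypothesis av : absolute_value abs.

Lemma absv0 : abs 0 = 0. Proof. by apply/(absv_eq0 av). Qed.

Lemma absv_gt0 x : (0 < abs x) = (x != 0).
Proof.
rewrite lt_def (absv_ge0 av) andbT; congr (~~ _).
by apply/eqP/eqP => /(absv_eq0 av).
Qed.

Lemma absv1 : abs 1 = 1.
Proof.
have h : abs 1 != 0 by rewrite gt_eqF// absv_gt0 oner_eq0.
by apply: (mulfI h); rewrite -(absvM av) !mulr1.
Qed.

Lemma absvX x n : abs (x ^+ n) = abs x ^+ n.
Proof. by elim: n => [|n ih]; rewrite ?absv1// !exprS (absvM av) ih. Qed.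

Lemma absvN x : abs (- x) = abs x.
Proof.
have h : abs (-1) = 1.
  apply/eqP; rewrite -(@eqrXn2 _ 2) ?(absv_ge0 av)//.
  by rewrite -absvX sqrrN !expr1n absv1.
by rewrite -mulN1r (absvM av) h mul1r.
Qed.

Lemma absvB x y : abs (x - y) = abs (y - x).
Proof. by rewrite -absvN opprB. Qed.

Lemma absvV x : abs x^-1 = (abs x)^-1.
Proof.
have [->|x0] := eqVneq x 0; first by rewrite invr0 absv0 invr0.
have h : abs x != 0 by rewrite gt_eqF// absv_gt0.
by apply: (mulfI h); rewrite -(absvM av) !divff// absv1.
Qed.

Lemma absvXz x (z : int) : abs (x ^ z) = abs x ^ z.
Proof. by case: z => n; rewrite /exprz/= ?absvV absvX. Qed.

Hypothesis nonarch : forall n : nat, abs n%:R <= 1.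

(** The binomial coefficients have absolute value at most 1, so the triangle inequality applied to
    (x + y)^n loses only the factor n + 1, which is negligible after n-th roots. *)
Lemma absv_ultra x y : abs (x + y) <= Num.max (abs x) (abs y).
Proof.
set M := Num.max _ _.
have M0 : 0 <= M by rewrite le_max (absv_ge0 av).
move: (M0); rewrite le_eqVlt => /predU1P[Mz|Mp].
  have xz : x = 0.
    apply/(absv_eq0 av)/eqP; rewrite eq_le (absv_ge0 av) andbT Mz.
    by rewrite le_max lexx.
  by rewrite xz add0r le_max lexx orbT.
have bound n : abs (x + y) ^+ n <= n.+1%:R * M ^+ n.
  rewrite -absvX exprDn.
  have sum_le (I : Type) (r : seq I) (G : I -> F) :
      abs (\sum_(i <- r) G i) <= \sum_(i <- r) abs (G i).
    elim: r => [|i r ih]; first by rewrite !big_nil absv0.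
    rewrite !big_cons (le_trans (absvD av _ _))//; exact: lerD.
  apply: (le_trans (sum_le _ _ _)).
  apply: (le_trans (y := \sum_(i < n.+1) M ^+ n)); last first.
    by rewrite sumr_const card_ord mulr_natl.
  apply: ler_sum => i _; rewrite -[X in abs X]mulr_natr !(absvM av).
  have -> : M ^+ n = M ^+ (n - i) * M ^+ i * 1.
    by rewrite mulr1 -exprD subnK// -ltnS.
  rewrite !absvX; apply: ler_pM => //.
  - by rewrite mulr_ge0// exprn_ge0// (absv_ge0 av).
  - exact: (absv_ge0 av).
  apply: ler_pM; rewrite ?exprn_ge0 ?(absv_ge0 av)//.
  - by rewrite lerXn2r ?nnegrE ?(absv_ge0 av)// le_max lexx.
  - by rewrite lerXn2r ?nnegrE ?(absv_ge0 av)// le_max lexx orbT.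
rewrite -[leRHS]mul1r -ler_pdivrMr//; apply: exprn_le_linear.
  by rewrite divr_ge0// (absv_ge0 av).
by move=> n; rewrite expr_div_n ler_pdivrMr ?exprn_gt0.
Qed.

Lemma absv_ultra_lt x y r : abs x < r -> abs y < r -> abs (x + y) < r.
Proof. by move=> xr yr; rewrite (le_lt_trans (absv_ultra _ _))// gt_max xr. Qed.

Lemma absv_ultra_le x y r : abs x <= r -> abs y <= r -> abs (x + y) <= r.
Proof. by move=> xr yr; rewrite (le_trans (absv_ultra _ _))// ge_max xr. Qed.

Lemma absvB_lt x y z r : abs (x - y) < r -> abs (y - z) < r -> abs (x - z) < r.
Proof. by move=> xy yz; rewrite -(subrKA y); exact: absv_ultra_lt. Qed.

Lemma absv_sum_le (I : Type) (s : seq I) (P : pred I) (G : I -> F) r :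
  0 <= r -> (forall i, P i -> abs (G i) <= r) -> abs (\sum_(i <- s | P i) G i) <= r.
Proof.
move=> r0 h; elim/big_rec : _ => [|i x Pi ih]; first by rewrite absv0.
by apply: absv_ultra_le => //; exact: h.
Qed.

Lemma absv_sum_lt (I : Type) (s : seq I) (P : pred I) (G : I -> F) r :
  0 < r -> (forall i, P i -> abs (G i) < r) -> abs (\sum_(i <- s | P i) G i) < r.
Proof.
move=> r0 h; elim/big_rec : _ => [|i x Pi ih]; first by rewrite absv0.
by apply: absv_ultra_lt => //; exact: h.
Qed.

Lemma absv_dominant x y : abs (x - y) < abs y -> abs x = abs y.
Proof.
move=> h; apply/eqP; rewrite eq_le; apply/andP; split.
  by rewrite -(subrK y x); apply: absv_ultra_le => //; exact: ltW.
rewrite leNgt; apply/negP => xy.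
have : abs (- (x - y) + x) < abs y by apply: absv_ultra_lt => //; rewrite absvN.
by rewrite opprB subrK ltxx.
Qed.

Lemma absv_int (z : int) : abs z%:~R <= 1.
Proof. by case: z => n; rewrite ?NegzE ?mulrNz ?absvN nonarch. Qed.

End AbsoluteValue.

(** * p-adic numbers *)

Section PadicField.
Variables (R : realType) (p : nat) (Qp : fieldType) (absp : Qp -> R).
Hypothesis p_prime : prime p.
Hypothesis pf : is_padic_field p absp.

Let av : absolute_value absp := padic_absv pf.

Let p_gt1 : 1 < p%:R :> R.
Proof. by rewrite ltr1n prime_gt1. Qed.

Let p_gt0 : 0 < p%:R :> R.
Proof. exact: lt_trans p_gt1. Qed.

Lemma padic_abs_nat (n : nat) : (0 < n)%N -> absp n%:R = (p%:R ^+ logn p n)^-1.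
Proof.
move=> n0; rewrite -(ratr_nat Qp) (padic_abs_rat pf) /rat_padic_abs.
rewrite pnatr_eq0 eqn0Ngt n0/=.
have -> : (n%:R : rat) = (n%:Z)%:~R by [].
by rewrite numq_int denq_int/= logn1 sub0r -invr_expz.
Qed.

Lemma padic_abs_nat_le1 (n : nat) : absp n%:R <= 1.
Proof.
have [->|n0] := posnP n; first by rewrite (absv0 av).
by rewrite padic_abs_nat// invf_le1 ?exprn_gt0// exprn_ege1// ltW.
Qed.

Lemma padic_abs_p : absp p%:R = p%:R^-1.
Proof.
rewrite padic_abs_nat ?prime_gt0// lognE p_prime prime_gt0// dvdnn divnn.
by rewrite prime_gt0//= logn1 expr1.
Qed.

Lemma padic_p_neq0 : p%:R != 0 :> Qp.
Proof. by rewrite -(absv_gt0 av) padic_abs_p invr_gt0. Qed.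

Lemma padic_abs_nat_dvd (n s : nat) :
  absp n%:R < (p%:R ^+ s)^-1 -> (p ^ s.+1 %| n)%N.
Proof.
have [->|n0] := posnP n; first by rewrite dvdn0.
rewrite padic_abs_nat// ltf_pV2 ?posrE ?exprn_gt0// ltr_eXn2l// => h.
by rewrite pfactor_dvdn.
Qed.

Lemma padic_abs_int_dvd (z : int) (s : nat) :
  absp z%:~R < (p%:R ^+ s)^-1 -> (p ^ s.+1 %| `|z|)%N.
Proof.
case: z => n; first by apply: padic_abs_nat_dvd.
rewrite NegzE mulrNz (absvN av) abszN; exact: padic_abs_nat_dvd.
Qed.

Lemma padic_abs_ratE (q : rat) : q != 0 ->
  exists z : int, absp (ratr q) = p%:R ^ z.
Proof. by move=> q0; rewrite (padic_abs_rat pf) /rat_padic_abs (negbTE q0); eexists. Qed.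

(** A rational closer to x than |x| has the same absolute value: completion does not enlarge the
    value group. *)
Lemma padic_absE (x : Qp) : x != 0 -> exists z : int, absp x = p%:R ^ z.
Proof.
rewrite -(absv_gt0 av) => x0.
have [q qx] := padic_dense pf x x0.
have e : absp (ratr q) = absp x.
  apply: (absv_dominant av padic_abs_nat_le1).
  by rewrite (absvB av).
have q0 : q != 0.
  apply/eqP => qz; move: x0; rewrite -e qz (ratr_nat Qp 0).
  by rewrite (absv0 av) ltxx.
by rewrite -e; exact: padic_abs_ratE.
Qed.

Lemma padic_abs_lt (x : Qp) (z : int) :
  absp x < p%:R ^ z -> absp x <= p%:R ^ (z - 1).
Proof.
have [->|x0] := eqVneq x 0.
  by rewrite (absv0 av) => _; rewrite exprz_ge0// ltW.
have [t ->] := padic_absE x0.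
by rewrite ltr_eXz2l// ler_eXz2l//; lia.
Qed.

Lemma padic_abs_lt1 (x : Qp) : absp x < 1 -> absp x <= p%:R^-1.
Proof. by rewrite -[1](expr0z p%:R) => /padic_abs_lt; rewrite sub0r. Qed.

Lemma padic_residue_eq (i j : nat) : (i < p)%N -> (j < p)%N ->
  absp (i%:R - j%:R) < 1 -> i = j.
Proof.
move=> ip jp; have -> : i%:R - j%:R = (i%:Z - j%:Z)%:~R :> Qp by rewrite rmorphB.
have one : 1 = (p%:R ^+ 0)^-1 :> R by rewrite expr0 invr1.
rewrite [ltRHS]one => /padic_abs_int_dvd; rewrite expn1.
have [->//|ij] := eqVneq i j.
by move=> /dvdn_leq; lia.
Qed.

Lemma padic_residue (x : Qp) : absp x <= 1 ->
  exists2 d : nat, (d < p)%N & absp (x - d%:R) < 1.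
Proof.
move=> x1; have [q xq] := padic_dense pf x ltr01.
have q1 : absp (ratr q) <= 1.
  rewrite -[ratr q](subKr x); apply: (absv_ultra_le av padic_abs_nat_le1) => //.
  by rewrite (absvN av) ltW.
suff [d dp qd] : exists2 d : nat, (d < p)%N & absp (ratr q - d%:R) < 1.
  by exists d => //; apply: (absvB_lt av padic_abs_nat_le1) qd.
have [q0|q0] := eqVneq q 0.
  exists 0%N; first exact: prime_gt0.
  by rewrite q0 subr0 (ratr_nat Qp 0) (absv0 av).
have pd : ~~ (p %| `|denq q|)%N.
  apply/negP => pd.
  have pn : ~~ (p %| `|numq q|)%N.
    apply/negP => pn; have := coprime_num_den q.
    rewrite /coprime => /eqP cop.
    have : (p %| 1)%N by rewrite -cop dvdn_gcd pn pd.
    by rewrite dvdn1 => /eqP p1; move: p_prime; rewrite p1.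
  move: q1; rewrite (padic_abs_rat pf) /rat_padic_abs (negbTE q0).
  rewrite [logn p `|numq q|]logn_coprime ?prime_coprime//.
  rewrite subr0 -(expr0z p%:R) ler_eXz2l//.
  have : (0 < logn p `|denq q|)%N by rewrite logn_gt0 mem_primes p_prime pd absz_gt0 denq_neq0.
  by lia.
(* A p-integral fraction in lowest terms has denominator prime to p; Bezout inverts it modulo p, and
   [u] is an integer congruent to q. *)
have [u up] : exists u : int, (p%:Z %| numq q - u * denq q)%Z.
  have /coprimezP[[u v]/= uv] : coprimez p%:Z (denq q).
    by rewrite coprimezE/= prime_coprime.
  exists (v * numq q); apply/dvdzP; exists (u * numq q).
  by transitivity (numq q * (u * p%:Z + v * denq q) - v * numq q * denq q);
    [rewrite uv; ring | ring].
pose d := `|(u %% p%:Z)%Z|%N.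
have pz : p%:Z != 0 by have := prime_gt0 p_prime; lia.
have dE : (d%:Z = (u %% p%:Z)%Z) by rewrite /d gez0_abs// modz_ge0.
have dp : (p%:Z %| numq q - d%:Z * denq q)%Z.
  rewrite dE.
  have -> : numq q - (u %% p)%Z * denq q = (numq q - u * denq q) + (u %/ p)%Z * denq q * p%:Z.
    by rewrite {2}(divz_eq u p%:Z); ring.
  by rewrite rpredD// dvdz_mull.
exists d.
  by rewrite -ltz_nat dE ltz_pmod// ltz_nat prime_gt0.
have den0 : (denq q)%:~R != 0 :> Qp.
  rewrite -(absv_gt0 av) -(gez0_abs (ltW (denq_gt0 q))) padic_abs_nat ?absz_gt0 ?denq_neq0//.
  by rewrite invr_gt0 exprn_gt0.
have den1 : absp (denq q)%:~R = 1.
  rewrite -(gez0_abs (ltW (denq_gt0 q))) padic_abs_nat ?absz_gt0 ?denq_neq0//.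
  by rewrite logn_coprime ?prime_coprime// expr0 invr1.
rewrite -[ltLHS]mulr1 -[X in _ * X < _]den1 -(absvM av) mulrBl /ratr divfK//.
have /dvdzP[w we] := dp.
have -> : (numq q)%:~R - d%:R * (denq q)%:~R = w%:~R * p%:R :> Qp.
  by rewrite -[d%:R]/(d%:Z%:~R) -[p%:R]/(p%:Z%:~R) -!intrM -rmorphB/= we.
rewrite (absvM av) padic_abs_p ltr_pdivrMr// mul1r.
exact: le_lt_trans (absv_int av padic_abs_nat_le1 _) p_gt1.
Qed.

(** * Digit expansions and the p-adic floor *)

Let padic_digit (y : Qp) : nat :=
  xget 0%N [set d : nat | (d < p)%N /\ absp (y - d%:R) < 1].

Let padic_digitP (y : Qp) : absp y <= 1 ->
  (padic_digit y < p)%N /\ absp (y - (padic_digit y)%:R) < 1.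
Proof.
move=> /padic_residue[d dp yd].
by rewrite /padic_digit; case: xgetP => [e _ //|/(_ d)]; case.
Qed.

Let padic_shift (y : Qp) : Qp := (y - (padic_digit y)%:R) / p%:R.

Let padic_shift_le1 (y : Qp) : absp y <= 1 -> absp (padic_shift y) <= 1.
Proof.
move=> /padic_digitP[_ /padic_abs_lt1]; rewrite (absvM av) (absvV av) padic_abs_p.
by rewrite invrK => h; rewrite -ler_pdivlMr// mul1r.
Qed.

Let padic_iter_le1 (y : Qp) n : absp y <= 1 -> absp (iter n padic_shift y) <= 1.
Proof. by move=> y1; elim: n => //= n; exact: padic_shift_le1. Qed.

Let padic_iterE (y : Qp) (N : nat) :
  y = \sum_(0 <= i < N) (padic_digit (iter i padic_shift y))%:R * p%:R ^+ i
      + iter N padic_shift y * p%:R ^+ N.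
Proof.
elim: N => [|N ih]; first by rewrite big_nil add0r expr0 mulr1.
rewrite big_nat_recr//= -addrA exprS mulrA [padic_shift _ * _]divfK ?padic_p_neq0//.
by rewrite -mulrDl subrKC.
Qed.

Lemma padic_expansion_exists (x : Qp) :
  exists (M : nat) (a : nat -> nat), padic_expansion p absp x M a.
Proof.
have [M xM] : exists M : nat, absp x <= p%:R ^+ M.
  have [->|x0] := eqVneq x 0.
    by exists 0%N; rewrite (absv0 av).
  have [z ->] := padic_absE x0; exists `|z|%N.
  by rewrite exprnP ler_eXz2l//; lia.
have pM0 : p%:R ^+ M != 0 :> Qp by rewrite expf_neq0// padic_p_neq0.
pose y := x * p%:R ^+ M.
have y1 : absp y <= 1.
  rewrite (absvM av) (absvX av) padic_abs_p exprVn -ler_pdivlMr ?invr_gt0 ?exprn_gt0//.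
  by rewrite invrK mul1r.
exists M, (fun i => padic_digit (iter i padic_shift y)); split=> [i|].
  by have [] := padic_digitP (padic_iter_le1 i y1).
have pM : p%:R ^+ M != 0 :> R by rewrite expf_neq0// gt_eqF.
have h N : absp (x - \sum_(0 <= i < N)
    (padic_digit (iter i padic_shift y))%:R * p%:R ^+ i / p%:R ^+ M)
    <= p%:R ^+ M * p%:R^-1 ^+ N.
  rewrite -mulr_suml.
  have -> : x = y / p%:R ^+ M by rewrite mulfK.
  rewrite -mulrBl {1}(padic_iterE y N) addrAC subrr add0r.
  rewrite !(absvM av) (absvV av) !(absvX av) padic_abs_p !exprVn invrK mulrC.
  rewrite ler_pM2l ?exprn_gt0// ler_piMl ?exprn_ge0 ?invr_ge0 ?(ltW p_gt0)//.
  exact: padic_iter_le1.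
apply: (@squeeze_cvgr _ _ _ _ (fun=> 0) (geometric (p%:R ^+ M) p%:R^-1)).
- by near=> N; rewrite (absv_ge0 av)/= h.
- exact: cvg_cst.
- by apply: cvg_geometric; rewrite ger0_norm ?invr_ge0 ?(ltW p_gt0)// invf_lt1.
Unshelve. all: by end_near. Qed.

Lemma padic_expansion_floor (x : Qp) (M : nat) (a : nat -> nat) :
  padic_expansion p absp x M a ->
  absp (x - \sum_(0 <= i < M.+1) (a i)%:R * p%:R ^+ i / p%:R ^+ M) < 1.
Proof.
move=> [ap /cvgr0Pnorm_lt /(_ _ ltr01) [N0 _ h]].
pose N := maxn N0 M.+1.
have := h N (leq_maxl _ _); rewrite /= ger0_norm ?(absv_ge0 av)// => xN.
apply: (absvB_lt av padic_abs_nat_le1 xN).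
rewrite (big_cat_nat (n := M.+1))//= ?leq_maxr// addrAC subrr add0r big_nat.
apply: (absv_sum_lt av padic_abs_nat_le1) => // i /andP[Mi _].
rewrite !(absvM av) (absvV av) !(absvX av) padic_abs_p !exprVn invrK.
rewrite -mulrA; apply: (le_lt_trans (y := (p%:R ^+ i)^-1 * p%:R ^+ M)).
  by rewrite ler_piMl ?mulr_ge0 ?invr_ge0 ?exprn_ge0 ?(ltW p_gt0)// padic_abs_nat_le1.
by rewrite mulrC ltr_pdivrMr ?exprn_gt0// mul1r ltr_eXn2l.
Qed.

(** The expansion behind the floor is an arbitrary choice. These properties hold for every choice
    and together determine the value, which takes the place of uniqueness of expansions. *)
Lemma padic_floorP (x : Qp) : absp (x - padic_floor p absp x) < 1 /\
  exists n M : nat, (n < p ^ M.+1)%N /\ padic_floor p absp x = n%:R / p%:R ^+ M.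
Proof.
rewrite /padic_floor; case: xgetP => [y _ /= [M [a [xa ye]]]|]; last first.
  have [M [a xa]] := padic_expansion_exists x.
  by move=> /(_ _ (ex_intro _ M (ex_intro _ a (conj xa erefl)))).
split; first by rewrite ye; exact: padic_expansion_floor.
exists (\sum_(0 <= i < M.+1) a i * p ^ i)%N, M; split; last first.
  by rewrite ye -mulr_suml natr_sum; congr (_ / _); apply: eq_bigr => i _; rewrite natrM natrX.
case: xa => ap _; elim: M.+1 => [|m ih]; first by rewrite big_nil.
rewrite big_nat_recr//=.
apply: (@leq_trans ((a m).+1 * p ^ m)%N); first by rewrite mulSn ltn_add2r.
by rewrite expnS leq_mul2r ap orbT.
Qed.

(* A difference of floors is z / p^s with z an integer divisible by p^(s+1)
   and smaller than p^(s+1). *)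
Lemma padic_floor_eq (x y : Qp) :
  absp (x - y) < 1 -> padic_floor p absp x = padic_floor p absp y.
Proof.
move=> xy; have [xf [n [M [nM xe]]]] := padic_floorP x.
have [yf [n' [M' [nM' ye]]]] := padic_floorP y.
rewrite {}xe in xf *; rewrite {}ye in yf *.
have pM k : p%:R ^+ k != 0 :> Qp by rewrite expf_neq0// padic_p_neq0.
have : absp (n%:R / p%:R ^+ M - n'%:R / p%:R ^+ M') < 1.
  rewrite (absvB av) in xf.
  apply: (absvB_lt av padic_abs_nat_le1 xf).
  exact: (absvB_lt av padic_abs_nat_le1 xy).
pose z : int := n%:Z * (p ^ M')%N%:Z - n'%:Z * (p ^ M)%N%:Z.
have -> : n%:R / p%:R ^+ M - n'%:R / p%:R ^+ M' = z%:~R / p%:R ^+ (M + M') :> Qp.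
  by rewrite /z rmorphB/= !intrM -!pmulrn !natrX exprD; field; rewrite !pM.
rewrite (absvM av) (absvV av) (absvX av) padic_abs_p exprVn invrK.
rewrite -ltr_pdivlMr ?exprn_gt0// mul1r => /padic_abs_int_dvd zd.
suff z0 : z = 0.
  apply/eqP; rewrite eqr_div//; apply/eqP.
  have : z%:~R = 0 :> Qp by rewrite z0.
  by rewrite /z rmorphB/= !intrM -!pmulrn !natrX => /eqP; rewrite subr_eq0 => /eqP.
have b1 : (n * p ^ M' < p ^ (M + M').+1)%N.
  by rewrite -addSn expnD ltn_mul2r expn_gt0 prime_gt0.
have b2 : (n' * p ^ M < p ^ (M + M').+1)%N.
  by rewrite addnC -addSn expnD ltn_mul2r expn_gt0 prime_gt0.
have [//|zn] := eqVneq z 0.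
have : (p ^ (M + M').+1 <= `|z|)%N by rewrite dvdn_leq// absz_gt0.
rewrite /z; lia.
Qed.

End PadicField.

(** * The extension K *)

Lemma euclid_remainder_inj (n i j : nat) (y z : int) : (i < n)%N -> (j < n)%N ->
  n%:Z * y + i%:Z = n%:Z * z + j%:Z -> i = j.
Proof.
move=> iN jN /(congr1 (fun t => (t %% n%:Z)%Z)).
rewrite ![n%:Z * _]mulrC !modzMDl !modz_small ?ltz_nat//.
by case.
Qed.

Section LocalField.
Variables (R : realType) (p : nat) (Qp : fieldType) (absp : Qp -> R).
Variables (K : fieldExtType Qp) (absK : K -> R) (e f : nat) (gamma beta : K).
Hypothesis p_prime : prime p.
Hypothesis pf : is_padic_field p absp.
Hypothesis avK : absolute_value absK.
Hypothesis absK_ext : forall x : Qp, absK (x%:A) = absp x.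
Hypothesis ramif : ramification_index absp absK fullv e.
Hypothesis resdeg : residue_degree absp absK fullv f.
Hypothesis gamma_prim : (p ^ f - 1)%N.-primitive_root gamma.
Hypothesis abs_beta : absK beta = p%:R `^ (e%:R^-1).

Let avp : absolute_value absp := padic_absv pf.

Let nap : forall n, absp n%:R <= 1 := padic_abs_nat_le1 p_prime pf.

Let p_gt1 : 1 < p%:R :> R.
Proof. by rewrite ltr1n prime_gt1. Qed.

Let p_gt0 : 0 < p%:R :> R.
Proof. exact: lt_trans p_gt1. Qed.

Lemma absK_scale (x : Qp) (y : K) : absK (x *: y) = absp x * absK y.
Proof. by rewrite -mulr_algl (absvM avK) absK_ext. Qed.

Lemma absK_nat_le1 (n : nat) : absK n%:R <= 1.
Proof. by rewrite -scaler_nat absK_ext; exact: nap. Qed.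

Let naK := absK_nat_le1.

Let rho : R := p%:R `^ (e%:R^-1).

Lemma ramification_gt0 : (0 < e)%N.
Proof.
have [x [_ /(_ 1 (memvf _) (oner_neq0 _)) [i _]]] := ramif.
exact: leq_ltn_trans (leq0n i) (ltn_ord i).
Qed.

Lemma uniformizer_expn : rho ^+ e = p%:R.
Proof.
rewrite /rho -powR_mulrn ?powR_ge0// -powRrM mulVf ?powRr1 ?ltW//.
by rewrite pnatr_eq0 -lt0n ramification_gt0.
Qed.

Lemma uniformizer_gt1 : 1 < rho.
Proof.
rewrite ltNge; apply/negP => h.
have := exprn_ile1 e (powR_ge0 _ _) h.
by rewrite -/rho uniformizer_expn leNgt p_gt1.
Qed.

Let rho_gt1 := uniformizer_gt1.

Let rho_gt0 : 0 < rho.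
Proof. exact: lt_trans rho_gt1. Qed.

Let rho_neq0 : rho != 0.
Proof. by rewrite gt_eqF. Qed.

Let p_rho (z : int) : p%:R ^ z = rho ^ (e%:Z * z) :> R.
Proof. by rewrite -exprz_exp -exprnP uniformizer_expn. Qed.

(** * Orthogonality of the products of powers of gamma and beta *)

Lemma abs_gamma : absK gamma = 1.
Proof.
have n0 := prim_order_gt0 gamma_prim.
apply/eqP; rewrite -(@eqrXn2 _ (p ^ f - 1)) ?(absv_ge0 avK)//.
by rewrite -(absvX avK) (prim_expr_order gamma_prim) (absv1 avK) expr1n.
Qed.

Lemma abs_gammaX i : absK (gamma ^+ i) = 1.
Proof. by rewrite (absvX avK) abs_gamma expr1n. Qed.

Let f_gt0 : (0 < f)%N.
Proof. by have := prim_order_gt0 gamma_prim; case: (f) => //; rewrite expn0. Qed.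

(** With n = p^f - 1, suppose an n-th root of unity z other than 1 were congruent to 1. The
    vanishing sum of its n powers is then congruent to n, so |n| < 1; since |n + 1| = |p^f| < 1,
    this would give |1| < 1. *)
Lemma gamma_powers_separated (i j : nat) : (i < p ^ f - 1)%N -> (j < p ^ f - 1)%N ->
  absK (gamma ^+ i - gamma ^+ j) < 1 -> i = j.
Proof.
have n0 := prim_order_gt0 gamma_prim.
set n := (p ^ f - 1)%N in n0 *.
wlog ij : i j / (i <= j)%N => [wlg|].
  move=> iN jN; have /orP[ij|ji] := leq_total i j; first exact: wlg.
  by rewrite (absvB avK) => h; apply/esym; exact: wlg.
move=> iN jN.
pose z := gamma ^+ (j - i).
have -> : gamma ^+ i - gamma ^+ j = gamma ^+ i * (1 - z).
  by rewrite mulrBr mulr1 -exprD subnKC.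
rewrite (absvM avK) abs_gammaX mul1r => z1.
suff : z = 1.
  move/eqP; rewrite -(prim_order_dvd gamma_prim) -/n => /dvdn_leq.
  by lia.
apply/eqP; apply/negP => /negP z1'.
have s0 : \sum_(t < n) z ^+ t = 0.
  have : z ^+ n - 1 = 0 by rewrite -exprM mulnC exprM (prim_expr_order gamma_prim) expr1n subrr.
  by rewrite subrX1 => /eqP; rewrite mulf_eq0 subr_eq0 (negbTE z1')/= => /eqP.
have zt t : absK (1 - z ^+ t) < 1.
  rewrite -{1}(expr1n _ t) subrXX_comm; last exact: commr_sym (commr1 _).
  rewrite (absvM avK) (le_lt_trans _ z1)// ler_piMr ?(absv_ge0 avK)//.
  apply: (absv_sum_le avK naK) => // i' _; rewrite expr1n mul1r /z -exprM.
  by rewrite abs_gammaX.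
have nlt : absK n%:R < 1.
  rewrite -[n%:R]subr0 -s0.
  have -> : n%:R = \sum_(t < n) 1 :> K by rewrite sumr_const card_ord.
  by rewrite -sumrB; apply: (absv_sum_lt avK naK).
have : absK (1 + n%:R) < 1.
  have -> : 1 + n%:R = (p ^ f)%:R :> K.
    by rewrite addrC natr1 /n subn1 prednK ?expn_gt0 ?prime_gt0.
  rewrite -scaler_nat absK_ext.
  rewrite (padic_abs_nat pf) ?expn_gt0 ?prime_gt0// pfactorK//.
  by rewrite invf_lt1 ?exprn_gt0// exprn_egt1// -lt0n.
move=> h; have : absK (1 + n%:R - n%:R) < 1.
  by apply: (absv_ultra_lt avK naK) => //; rewrite (absvN avK).
by rewrite addrK (absv1 avK) ltxx.
Qed.

(* Otherwise some power gamma^d, d < f, is congruent to a combination of the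
   lower ones, so that all powers of gamma, and 0, would lie in p^d residue
   classes, whereas they are p^f pairwise incongruent elements. *)
Lemma gamma_residues_free (b : nat -> Qp) :
  (forall j, absp (b j) <= 1) ->
  absK (\sum_(0 <= j < f) b j *: gamma ^+ j) < 1 ->
  forall j, (j < f)%N -> absp (b j) < 1.
Proof.
move=> b1 sb j jf; rewrite ltNge; apply/negP => bj.
have exd : exists d, (d < f)%N && (1 <= absp (b d)) by exists j; rewrite jf.
have ubd d : (d < f)%N && (1 <= absp (b d)) -> (d <= f)%N by move=> /andP[/ltnW].
(* [d] is the last index with a unit coefficient: the later terms are negligible, and the relation
   can be solved for [gamma ^+ d]. *)
case: (ex_maxnP exd ubd) => d /andP[df bd] dmax.
have bd1 : absp (b d) = 1 by apply/eqP; rewrite eq_le b1.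
have bd0 : b d != 0 by rewrite -(absv_gt0 avp) bd1.
have {}sb : absK (\sum_(0 <= j < d.+1) b j *: gamma ^+ j) < 1.
  rewrite (_ : \sum_(0 <= j < d.+1) _ = \sum_(0 <= j < f) b j *: gamma ^+ j
    - \sum_(d.+1 <= j < f) b j *: gamma ^+ j); last first.
    by rewrite (@big_cat_nat _ _ _ d.+1 0 f)//= addrK.
  apply: (absv_ultra_lt avK naK) => //; rewrite (absvN avK) big_nat.
  apply: (absv_sum_lt avK naK) => // i /andP[di iF].
  rewrite absK_scale abs_gammaX mulr1 ltNge; apply/negP => bi.
  by have := dmax i; rewrite iF bi => /(_ isT); rewrite leqNgt di.
pose c j := - (b j / b d).
have c1 i : absp (c i) <= 1 by rewrite (absvN avp) (absvM avp) (absvV avp) bd1 invr1 mulr1.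
have red (u : nat -> Qp) : (forall i, absp (u i) <= 1) ->
    exists2 v : nat -> Qp, (forall i, absp (v i) <= 1) &
    absK (\sum_(0 <= i < d.+1) u i *: gamma ^+ i - \sum_(0 <= i < d) v i *: gamma ^+ i) < 1.
  move=> u1; exists (fun i => u i + u d * c i) => [i|].
    apply: (absv_ultra_le avp nap) => //.
    by rewrite (absvM avp) mulr_ile1 ?(absv_ge0 avp).
  have -> : \sum_(0 <= i < d.+1) u i *: gamma ^+ i
      - \sum_(0 <= i < d) (u i + u d * c i) *: gamma ^+ i
      = (u d / b d) *: \sum_(0 <= i < d.+1) b i *: gamma ^+ i.
    rewrite !big_nat_recr//= scalerDr scalerA divfK// addrAC; congr (_ + _).
    rewrite -sumrB scaler_sumr; apply: eq_bigr => i _.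
    by rewrite -scalerBl scalerA; congr (_ *: _); rewrite /c; field.
  rewrite absK_scale (absvM avp) (absvV avp) bd1 invr1 mulr1.
  by rewrite (le_lt_trans _ sb)// ler_piMl ?(absv_ge0 avK).
have gam n : exists2 v : nat -> Qp, (forall i, absp (v i) <= 1) &
    absK (gamma ^+ n - \sum_(0 <= i < d) v i *: gamma ^+ i) < 1.
  elim: n => [|n [v v1 hv]].
    have [i|v v1 hv] := red (fun i => (i == 0)%:R).
      by case: (i == 0); rewrite ?(absv1 avp) ?(absv0 avp).
    exists v => //; move: hv; rewrite big_nat_recl//= scale1r big1 ?addr0//.
    by move=> i _; rewrite scale0r.
  have [[|i]//=|w w1 hw] := red (fun i => if i is i'.+1 then v i' else 0).
    by rewrite (absv0 avp).
  exists w => //; apply: (absvB_lt avK naK) hw.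
  rewrite big_nat_recl//= scale0r add0r.
  have -> : gamma ^+ n.+1 - \sum_(0 <= i < d) v i *: gamma ^+ i.+1
     = gamma * (gamma ^+ n - \sum_(0 <= i < d) v i *: gamma ^+ i).
    rewrite exprS mulrBr mulr_sumr; congr (_ - _); apply: eq_bigr => i _.
    by rewrite exprS scalerAr.
  by rewrite (absvM avK) abs_gamma mul1r.
have dig n : exists t : {ffun 'I_d -> 'I_p},
    absK (gamma ^+ n - \sum_(i < d) (t i)%:R *: gamma ^+ i) < 1.
  have [v v1 hv] := gam n.
  have /choice[t ht] : forall i : 'I_d, exists t : 'I_p, absp (v i - t%:R) < 1.
    move=> i; have [t tp vt] := padic_residue p_prime pf (v1 i).
    by exists (Ordinal tp).
  exists [ffun i => t i]; apply: (absvB_lt avK naK hv).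
  rewrite big_mkord -sumrB; apply: (absv_sum_lt avK naK) => // i _.
  by rewrite -scalerBl absK_scale abs_gammaX mulr1 ffunE ht.
have [g hg] := choice dig.
pose E (o : option 'I_(p ^ f - 1)) : K := if o is Some i then gamma ^+ i else 0.
pose D (t : {ffun 'I_d -> 'I_p}) : K := \sum_(i < d) (t i)%:R *: gamma ^+ i.
have pp : (0 < p)%N by exact: prime_gt0.
pose G (o : option 'I_(p ^ f - 1)) : {ffun 'I_d -> 'I_p} :=
  if o is Some i then g i else [ffun=> Ordinal pp].
have EG o : absK (E o - D (G o)) < 1.
  case: o => [i|] /=; first exact: hg.
  by rewrite /D big1 ?subr0 ?(absv0 avK)// => i _; rewrite ffunE scale0r.
have Ginj : injective G.
  move=> o o' oo.
  have : absK (E o - E o') < 1.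
    apply: (absvB_lt avK naK (EG o)); rewrite (absvB avK) oo; exact: EG.
  case: o {oo} => [i|]; case: o' => [i'|] //=.
  - by move=> /gamma_powers_separated h; congr Some; apply/val_inj/h.
  - by rewrite subr0 abs_gammaX ltxx.
  - by rewrite sub0r (absvN avK) abs_gammaX ltxx.
have := leq_card G Ginj.
rewrite card_option card_ffun !card_ord subn1 prednK ?expn_gt0 ?pp//.
by rewrite leq_exp2l ?prime_gt1// leqNgt df.
Qed.


Lemma fin_argmax (I : finType) (i0 : I) (G : I -> R) :
  exists i, forall j, G j <= G i.
Proof.
exists [arg max_(i > i0) G i]%O.
by case: Order.TotalTheory.arg_maxP => // i _ h j; exact: h.
Qed.

(** Division by the largest coefficient reduces to integral coefficients, one of them equal to 1,
    where the independence of the residues applies. Naming an index [j0] that attains the maximum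
    also shows that the norm is a value of [absp], which keeps the terms with different powers of
    beta in different cosets. *)
Lemma gamma_norm (b : 'I_f -> Qp) : exists j0,
  absK (\sum_(j < f) b j *: gamma ^+ j) = absp (b j0) /\
  forall j, absp (b j) <= absp (b j0).
Proof.
have [j0 hj0] := fin_argmax (Ordinal f_gt0) (fun j => absp (b j)).
exists j0; split => //; apply/eqP; rewrite eq_le; apply/andP; split.
  apply: (absv_sum_le avK naK) => [|j _]; first exact: (absv_ge0 avp).
  by rewrite absK_scale abs_gammaX mulr1.
have [b0|b0] := eqVneq (b j0) 0; first by rewrite b0 (absv0 avp) (absv_ge0 avK).
rewrite leNgt; apply/negP => h.
pose b' n := if insub n is Some j then b j / b j0 else 0.
have b'E (j : 'I_f) : b' j = b j / b j0 by rewrite /b' valK.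
have bp : 0 < absp (b j0) by rewrite (absv_gt0 avp).
have : absp (b' j0) < 1.
  apply: gamma_residues_free => //.
    move=> j; rewrite /b'; case: insub => [i|]; last by rewrite (absv0 avp).
    by rewrite (absvM avp) (absvV avp) ler_pdivrMr ?mul1r.
  rewrite big_mkord.
  have -> : \sum_(j < f) b' j *: gamma ^+ j = (b j0)^-1 *: \sum_(j < f) b j *: gamma ^+ j.
    rewrite scaler_sumr; apply: eq_bigr => j _; rewrite b'E scalerA; congr (_ *: _).
    exact: mulrC.
  by rewrite absK_scale (absvV avp) mulrC ltr_pdivrMr ?mul1r.
by rewrite b'E divff// (absv1 avp) ltxx.
Qed.

Lemma combE (b : 'I_e -> 'I_f -> Qp) :
  comb gamma beta b = \sum_(i < e) (\sum_(j < f) b i j *: gamma ^+ j) * beta ^+ i.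
Proof.
apply: eq_bigr => i _; rewrite mulr_suml; apply: eq_bigr => j _.
by rewrite scalerAl.
Qed.

Let abs_betaX i : absK (beta ^+ i) = rho ^+ i.
Proof. by rewrite (absvX avK) abs_beta. Qed.

(* Nonzero terms have absolute values in distinct cosets of the value group. *)
Lemma comb_norm (b : 'I_e -> 'I_f -> Qp) i j :
  absp (b i j) * rho ^+ i <= absK (comb gamma beta b).
Proof.
have /choice[y hy] : forall i : 'I_e, exists y : Qp,
    absK (\sum_(j < f) b i j *: gamma ^+ j) = absp y /\ forall j, absp (b i j) <= absp y.
  by move=> i'; have [j0 ?] := gamma_norm (b i'); exists (b i' j0).
rewrite combE; set s := fun i : 'I_e => (\sum_(j < f) b i j *: gamma ^+ j) * beta ^+ i.
have sE i' : absK (s i') = absp (y i') * rho ^+ i'.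
  by rewrite /s (absvM avK) (hy i').1 abs_betaX.
have [i0 hi0] := fin_argmax i (fun i => absK (s i)).
suff -> : absK (\sum_(i < e) s i) = absK (s i0).
  apply: (le_trans _ (hi0 i)); rewrite sE ler_wpM2r ?exprn_ge0 ?(ltW rho_gt0)//.
  exact: (hy i).2.
have [s0|s0] := eqVneq (absK (s i0)) 0.
  apply/eqP; rewrite s0 eq_le (absv_ge0 avK) andbT.
  by apply: (absv_sum_le avK naK) => // i' _; rewrite -s0 hi0.
have sp : 0 < absK (s i0) by rewrite lt_def s0 (absv_ge0 avK).
apply: (absv_dominant avK naK); rewrite (bigD1 i0)//= addrAC subrr add0r.
apply: (absv_sum_lt avK naK) => // i' ii0; rewrite lt_neqAle hi0 andbT.
have [y0|y0] := eqVneq (y i') 0.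
  by rewrite sE y0 (absv0 avp) mul0r eq_sym.
have y00 : y i0 != 0 by apply: contraNneq s0 => yz; rewrite sE yz (absv0 avp) mul0r.
have [z hz] := padic_absE p_prime pf y0; have [z0 hz0] := padic_absE p_prime pf y00.
rewrite !sE hz hz0 !p_rho !exprnP -!(expfzDr _ _ rho_neq0).
apply: contra ii0 => /eqP/(ieexprIz rho_gt0) h; apply/eqP/val_inj => /=.
have {}h := h (negbT (gt_eqF rho_gt1)).
exact: euclid_remainder_inj (ltn_ord i') (ltn_ord i0) h.
Qed.

Lemma combB (b b' : 'I_e -> 'I_f -> Qp) :
  comb gamma beta (fun i j => b i j - b' i j) = comb gamma beta b - comb gamma beta b'.
Proof.
rewrite /comb -sumrB; apply: eq_bigr => i _.
by rewrite -sumrB; apply: eq_bigr => j _; rewrite scalerBl.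
Qed.

(** The [rho ^+ i] with i < e lie in distinct cosets of the powers of p. As there are exactly e
    cosets, they can replace the unspecified representatives supplied by [ramif]. *)
Lemma absK_beta_coset (x : K) : x != 0 ->
  exists (z : int) (i : 'I_e), absK x = p%:R ^ z * rho ^+ i.
Proof.
have [r [r_ne0 r_ex]] := ramif.
have beta0 : beta != 0 by rewrite -(absv_gt0 avK) abs_beta.
have coset (y : K) : y != 0 -> exists (z : int) (i : 'I_e), absK y = p%:R ^ z * absK (r i).
  move=> y0; have [i [[q qy] _]] := r_ex y (memvf _) y0.
  have q0 : q != 0.
    by apply: contraTneq y0 => q0; rewrite -(absv_gt0 avK) qy q0 (absv0 avp) mul0r ltxx.
  by have [z qz] := padic_absE p_prime pf q0; exists z, i; rewrite qy qz.
have p0 : p%:R != 0 :> R by rewrite gt_eqF.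
have rp i : absK (r i) != 0 by rewrite gt_eqF// (absv_gt0 avK); exact: (r_ne0 i).2.
have /choice[g hg] : forall i : 'I_e, exists j : 'I_e,
    exists z : int, rho ^+ i = p%:R ^ z * absK (r j).
  move=> i; have [z [j h]] := coset _ (expf_neq0 i beta0).
  by exists j, z; rewrite -abs_betaX.
have ginj : injective g.
  move=> i j gij; have [z hz] := hg i; have [z' hz'] := hg j.
  rewrite gij in hz.
  have : rho ^+ i * p%:R ^ z' = rho ^+ j * p%:R ^ z.
    by rewrite hz hz' [RHS]mulrAC [LHS]mulrAC [p%:R ^ z * _]mulrC.
  rewrite !p_rho !exprnP -!(expfzDr _ _ rho_neq0) => /(ieexprIz rho_gt0) h.
  have {}h := h (negbT (gt_eqF rho_gt1)).
  apply/val_inj => /=; rewrite !(addrC _ (e%:Z * _)) in h.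
  exact: euclid_remainder_inj (ltn_ord i) (ltn_ord j) h.
move=> x0; have [z [j xz]] := coset x x0.
have [i gi] : exists i, g i = j.
  by have /codomP[i ->] := injF_onto ginj j; exists i.
have [z' hz'] := hg i; exists (z - z'), i.
by rewrite hz' mulrA -expfzDr// subrK gi.
Qed.

Lemma absKE (x : K) : x != 0 -> exists z : int, absK x = rho ^ z.
Proof.
move=> /absK_beta_coset[z [i ->]]; exists (e%:Z * z + i%:Z).
by rewrite p_rho exprnP expfzDr// gt_eqF.
Qed.

Lemma absK_lt (x : K) (z : int) : absK x < rho ^ z -> absK x <= rho ^ (z - 1).
Proof.
have [->|x0] := eqVneq x 0.
  by rewrite (absv0 avK) => _; rewrite exprz_ge0// ltW.
have [t ->] := absKE x0.
by rewrite ltr_eXz2l// ler_eXz2l//; lia.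
Qed.

(** A full system of representatives of the residue field whose coefficients lie in [Qp], so that a
    multiple of one by a power of p and a power of beta is a [comb]. *)
Definition gamma_digits (t : {ffun 'I_f -> 'I_p}) : K :=
  \sum_(j < f) (t j)%:R *: gamma ^+ j.

Lemma gamma_digits_inj (t t' : {ffun 'I_f -> 'I_p}) :
  absK (gamma_digits t - gamma_digits t') < 1 -> t = t'.
Proof.
rewrite /gamma_digits -sumrB => h; apply/ffunP => j; apply/val_inj.
apply: (padic_residue_eq p_prime pf (ltn_ord _) (ltn_ord _)).
have [j0 [hn /(_ j) /= hj]] := gamma_norm (fun j => (t j)%:R - (t' j)%:R).
apply: (le_lt_trans hj); rewrite -hn.
by under eq_bigr do rewrite scalerBl.
Qed.

(* Pigeonhole: there are p^f residue classes, and as many digit vectors. *)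
Lemma gamma_digits_residue (x : K) : absK x <= 1 ->
  exists t, absK (x - gamma_digits t) < 1.
Proof.
have [u [u1 uex ufree]] := resdeg.
have rep (y : K) : absK y <= 1 -> exists s : {ffun 'I_f -> 'I_p},
    absK (y - \sum_(j < f) (s j)%:R *: u j) < 1.
  move=> y1; have [a [a1 ya]] := uex y (memvf _) y1.
  have /choice[s hs] : forall j : 'I_f, exists s : 'I_p, absp (a j - s%:R) < 1.
    move=> j; have [s sp h] := padic_residue p_prime pf (a1 j).
    by exists (Ordinal sp).
  exists [ffun j => s j]; apply: (absvB_lt avK naK ya).
  rewrite -sumrB; apply: (absv_sum_lt avK naK) => // j _.
  rewrite -scalerBl absK_scale ffunE.
  by rewrite (le_lt_trans _ (hs j))// ler_piMr ?(absv_ge0 avp)//; exact: (u1 j).2.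
have dig1 t : absK (gamma_digits t) <= 1.
  apply: (absv_sum_le avK naK) => // j _.
  by rewrite absK_scale abs_gammaX mulr1; exact: nap.
have [g hg] := choice (fun t => rep _ (dig1 t)).
have ginj : injective g.
  move=> t t' tt; apply: gamma_digits_inj.
  by apply: (absvB_lt avK naK (hg t)); rewrite (absvB avK) tt; exact: hg.
move=> x1; have [s hs] := rep x x1.
have [t ts] : exists t, g t = s.
  by have /codomP[t ->] := injF_onto ginj s; exists t.
exists t; apply: (absvB_lt avK naK hs).
by rewrite (absvB avK) -ts; exact: hg.
Qed.

Lemma comb_norm_le (b : 'I_e -> 'I_f -> Qp) (r : R) : 0 <= r ->
  (forall i j, absp (b i j) * rho ^+ i <= r) -> absK (comb gamma beta b) <= r.
Proof.
move=> r0 h; apply: (absv_sum_le avK naK) => // i _.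
apply: (absv_sum_le avK naK) => // j _.
by rewrite absK_scale (absvM avK) abs_gammaX abs_betaX mul1r.
Qed.

Let comb0 : comb gamma beta (fun (_ : 'I_e) (_ : 'I_f) => 0) = 0.
Proof. by apply: big1 => i _; apply: big1 => j _; rewrite scale0r. Qed.

(** One leading digit is extracted: x is divided by some w = p^(-z) beta^i with |w| = |x|, the sign
    of the exponent coming from |p| = 1/p, and x / w is replaced by its residue representative.
    Discreteness of the values turns an error below |x| into one of at most |x| / rho. *)
Lemma comb_approx1 (x : K) : exists b : 'I_e -> 'I_f -> Qp,
  absK (x - comb gamma beta b) <= absK x / rho.
Proof.
have [->|x0] := eqVneq x 0.
  by exists (fun _ _ => 0); rewrite comb0 subr0 (absv0 avK) mul0r.
have [z [i xE]] := absK_beta_coset x0.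
pose u : Qp := p%:R ^ (- z).
pose w : K := u *: beta ^+ i.
have aw : absK w = absK x.
  rewrite xE absK_scale abs_betaX (absvXz avp) (padic_abs_p p_prime pf).
  by rewrite exprz_inv opprK.
have w0 : w != 0 by rewrite -(absv_gt0 avK) aw (absv_gt0 avK).
have [t xt] : exists t, absK (x / w - gamma_digits t) < 1.
  apply: gamma_digits_residue.
  by rewrite (absvM avK) (absvV avK) aw divff// gt_eqF// (absv_gt0 avK).
exists (fun i' j => if i' == i then u * (t j)%:R else 0).
have -> : comb gamma beta (fun i' j => if i' == i then u * (t j)%:R else 0)
    = w * gamma_digits t.
  rewrite combE (bigD1 i)//= [X in _ + X]big1 ?addr0; last first.
    move=> i' /negbTE ii; rewrite ii big1 ?mul0r// => j _; rewrite scale0r//.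
  rewrite eqxx /w /gamma_digits -scalerAl mulrC scalerAr scaler_sumr; congr (_ * _).
  by apply: eq_bigr => j _; rewrite scalerA.
have -> : x - w * gamma_digits t = w * (x / w - gamma_digits t).
  by rewrite mulrBr [w * (x / w)]mulrC divfK.
rewrite (absvM avK) aw ler_pM2l ?(absv_gt0 avK)//.
by have := @absK_lt (x / w - gamma_digits t) 0; rewrite expr0z => /(_ xt).
Qed.

Lemma comb_approx (x : K) (n : nat) : exists b : 'I_e -> 'I_f -> Qp,
  absK (x - comb gamma beta b) <= absK x / rho ^+ n.
Proof.
elim: n => [|n [b hb]].
  by exists (fun _ _ => 0); rewrite comb0 subr0 expr0 divr1.
have [b' hb'] := comb_approx1 (x - comb gamma beta b).
exists (fun i j => b i j - - b' i j).
rewrite (combB b (fun i j => - b' i j)).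
have -> : comb gamma beta (fun i j => - b' i j) = - comb gamma beta b'.
  have := combB (fun _ _ => 0) b'; rewrite comb0 sub0r => <-.
  by congr (comb _ _ _); apply/funext => i; apply/funext => j; rewrite sub0r.
rewrite opprK opprD addrA (le_trans hb')// exprSr invfM mulrA.
by rewrite ler_pM2r// invr_gt0.
Qed.

(** The lower bound [comb_norm] makes the coordinates of the successive approximations Cauchy, the
    completeness of [Qp] gives their limits, and the upper bound [comb_norm_le] carries the limit
    back to K. *)
Lemma comb_surj (x : K) : exists b : 'I_e -> 'I_f -> Qp, x = comb gamma beta b.
Proof.
have [->|x0] := eqVneq x 0; first by exists (fun _ _ => 0).
have xp : 0 < absK x by rewrite (absv_gt0 avK).
have [B hB] := choice (comb_approx x).
have rn n : 0 < rho ^+ n by rewrite exprn_gt0.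
have decr N n : (N <= n)%N -> absK x / rho ^+ n <= absK x / rho ^+ N.
  by move=> Nn; rewrite ler_pM2l// lef_pV2 ?posrE// ler_eXn2l.
have cauchy i j N m n : (N <= m)%N -> (N <= n)%N ->
    absp (B m i j - B n i j) <= absK x / rho ^+ N / rho ^+ i.
  move=> Nm Nn; rewrite ler_pdivlMr//.
  apply: le_trans (comb_norm (fun i j => B m i j - B n i j) i j) _.
  rewrite (combB (B m) (B n)) -(subrKA x) addrC.
  apply: (absv_ultra_le avK naK); last rewrite (absvB avK).
    exact: le_trans (hB n) (decr _ _ Nn).
  exact: le_trans (hB m) (decr _ _ Nm).
have /choice[l hl] : forall ij : 'I_e * 'I_f, exists l : Qp, forall n,
    absp (B n ij.1 ij.2 - l) <= absK x / rho ^+ n / rho ^+ ij.1.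
  case=> i j /=; have [eps eps0|l hl] := padic_complete pf (u := fun n => B n i j).
    have [N hN] := exprn_unbounded (absK x / eps) rho_gt1.
    exists N => m n Nm Nn; apply: le_lt_trans (cauchy i j N m n Nm Nn) _.
    apply: (le_lt_trans (y := absK x / rho ^+ N)).
      rewrite ler_piMr ?divr_ge0 ?(ltW xp) ?(ltW (rn _))//.
      by rewrite invf_le1// exprn_ege1// ltW.
    by rewrite ltr_pdivrMr// mulrC -ltr_pdivrMr.
  exists l => n; set d := leRHS.
  have d0 : 0 < d by rewrite /d !divr_gt0.
  have /cvgr0Pnorm_lt/(_ _ d0)[N _ hN] := hl.
  have := hN (maxn N n) (leq_maxl _ _); rewrite /= ger0_norm ?(absv_ge0 avp)// => h.
  rewrite -(subrKA (B (maxn N n) i j)); apply: (absv_ultra_le avp nap); last exact: ltW.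
  by apply: cauchy => //; rewrite leq_maxr.
exists (fun i j => l (i, j)); apply/eqP; rewrite -subr_eq0; apply/negPn/negP => h.
have {}h : 0 < absK (x - comb gamma beta (fun i j => l (i, j))) by rewrite (absv_gt0 avK).
have [n hn] := exprn_unbounded (absK x / absK (x - comb gamma beta (fun i j => l (i, j)))) rho_gt1.
move: hn; rewrite ltr_pdivrMr// mulrC -ltr_pdivrMr// ltNge => /negP; apply.
rewrite -(subrKA (comb gamma beta (B n))); apply: (absv_ultra_le avK naK); first exact: hB.
rewrite -(combB (B n)); apply: comb_norm_le => [|i j]; first by rewrite divr_ge0// ltW.
by rewrite -ler_pdivlMr//; exact: (hl (i, j)).
Qed.

(** * The floor of K *)

Let fl := cf_floor p absp e f gamma beta.

Lemma coordsK (x : K) : comb gamma beta (coords (e := e) (f := f) gamma beta x) = x.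
Proof.
rewrite /coords; case: xgetP => [b _ /= ->//|h].
by have [b xb] := comb_surj x; have := h b xb.
Qed.

(** The factors |beta^i| can be as large as rho^(e-1), but a coordinate error less than 1 is at most
    1/p by discreteness, and rho^(e-1) < p. *)
Lemma cf_floor_lt1 (x : K) : absK (x - fl x) < 1.
Proof.
rewrite -{1}(coordsK x) /fl /cf_floor -combB.
have rp : rho ^+ e.-1 / p%:R < 1.
  rewrite ltr_pdivrMr// mul1r -uniformizer_expn ltr_eXn2l//.
  by rewrite prednK// ramification_gt0.
apply: le_lt_trans rp; apply: comb_norm_le => [|i j].
  by rewrite divr_ge0// ?exprn_ge0 ?ltW.
rewrite mulrC ler_pM ?exprn_ge0 ?(ltW rho_gt0) ?(absv_ge0 avp)//.
  by rewrite ler_eXn2l// -ltnS prednK ?ramification_gt0.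
exact: padic_abs_lt1 p_prime pf _ (padic_floorP p_prime pf _).1.
Qed.

(** By orthogonality, and because |beta^i| >= 1, corresponding coordinates of x and y differ by less
    than 1, so they have equal p-adic floors. *)
Lemma cf_floor_eq (x y : K) : absK (x - y) < 1 -> fl x = fl y.
Proof.
move=> xy; rewrite /fl /cf_floor; congr comb; apply/funext => i; apply/funext => j.
apply: (padic_floor_eq p_prime pf).
have := comb_norm (fun i j => coords gamma beta x i j - coords gamma beta y i j) i j.
rewrite combB !coordsK => h; apply: le_lt_trans xy; apply: le_trans h.
by rewrite ler_peMr ?(absv_ge0 avp)// exprn_ege1// ltW.
Qed.

(** Coordinates of a floor are quotients n / p^M of naturals. Countability is what makes the partial
    quotients discrete random variables. *)
Lemma countable_cf_floor : countable (range fl).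
Proof.
pose g (w : {ffun 'I_e * 'I_f -> nat * nat}) : K :=
  comb gamma beta (fun i j => (w (i, j)).1%:R / p%:R ^+ (w (i, j)).2).
apply: (@sub_countable _ _ _ (range g)); last first.
  exact/(sub_countable (card_image_le _ _))/countableP.
apply: subset_card_le => _ [x _ <-].
have /choice[w hw] : forall ij : 'I_e * 'I_f, exists w : nat * nat,
    padic_floor p absp (coords gamma beta x ij.1 ij.2) = w.1%:R / p%:R ^+ w.2.
  move=> ij; have [_ [n [M [_ h]]]] := padic_floorP p_prime pf (coords gamma beta x ij.1 ij.2).
  by exists (n, M).
exists [ffun ij => w ij] => //; rewrite /g /fl /cf_floor; congr comb.
by apply/funext => i; apply/funext => j; rewrite ffunE -hw.
Qed.

End LocalField.

(** * Random variables with countably many values *)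

Section DiscreteVariable.
Context {d : measure_display} {T : measurableType d} {R : realType}.
Variables (mu : {measure set T -> \bar R}) (D : set T).
Hypothesis mD : measurable D.

(** The target carries no sigma-algebra: with countably many values, measurable fibers make every
    function of [Z] measurable. This is what allows an arbitrary H. *)
Definition discrete_on {V : choiceType} (Z : T -> V) : Prop :=
  (exists2 A : set V, countable A & forall x, D x -> A (Z x)) /\
  (forall v, measurable (D `&` Z @^-1` [set v])).

Lemma discrete_preimage {V : choiceType} (Z : T -> V) (S : set V) :
  discrete_on Z -> measurable (D `&` Z @^-1` S).
Proof.
move=> [[A /countable_injP[c cinj] ZA] mZ].
rewrite (_ : _ `&` _ =
    \bigcup_n (\bigcup_(v in [set v | [/\ A v, S v & c v = n]]) (D `&` Z @^-1` [set v]))).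
  apply: bigcup_measurable => n _.
  have [[v [Av Sv cv]]|no] := pselect (exists v, [/\ A v, S v & c v = n]).
    rewrite (_ : [set _ | _] = [set v]) ?bigcup_set1//.
    apply/seteqP; split=> [w [Aw _ cw]|_ ->//]; apply: cinj; rewrite ?inE//.
    by rewrite cv cw.
  rewrite (_ : [set _ | _] = set0) ?bigcup_set0//.
  by apply/seteqP; split=> // v h; apply: no; exists v.
apply/seteqP; split=> [x [Dx Sx]|x [n _ [v [_ Sv _] [Dx /= ->]]]//].
by exists (c (Z x)) => //; exists (Z x) => //; split => //; exact: ZA.
Qed.

Lemma discrete_comp {V W : choiceType} (Z : T -> V) (g : V -> W) :
  discrete_on Z -> discrete_on (g \o Z).
Proof.
move=> dZ; split; last first.
  by move=> w; rewrite comp_preimage; exact: discrete_preimage.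
have [[A cA ZA] _] := dZ; exists (g @` A); last by move=> x /ZA Ax; exists (Z x).
exact: sub_countable (card_image_le _ _) cA.
Qed.

Lemma discrete_pair {V W : choiceType} (Z : T -> V) (Y : T -> W) :
  discrete_on Z -> discrete_on Y -> discrete_on (fun x => (Z x, Y x)).
Proof.
move=> [[A cA ZA] mZ] [[B cB YB] mY]; split.
  by exists (A `*` B) => [|x Dx]; [exact: countableX | split; [exact: ZA | exact: YB]].
move=> [v w]; rewrite (_ : _ `&` _ = (D `&` Z @^-1` [set v]) `&` (D `&` Y @^-1` [set w])).
  exact: measurableI.
by apply/seteqP; split=> [x [Dx [<- <-]]|x [[Dx /= ->] [_ /= ->]]].
Qed.

Lemma discrete_measurable_fun {V : choiceType} (Z : T -> V) d' (U : measurableType d')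
    (g : V -> U) : discrete_on Z -> measurable_fun D (fun x => g (Z x)).
Proof.
by move=> dZ _ Y mY; exact: (@discrete_preimage _ Z (g @^-1` Y)).
Qed.

Local Open Scope ereal_scope.

Lemma discrete_integral {V : choiceType} (Z : T -> V) (g : V -> \bar R) :
  discrete_on Z -> (forall v, 0 <= g v) ->
  \int[mu]_(x in D) g (Z x) =
    \esum_(v in [set: V]) (g v * mu (D `&` Z @^-1` [set v])).
Proof.
move=> dZ g0; have [[A /countable_injP[c cinj] ZA] mZ] := dZ.
pose F n := D `&` (c \o Z) @^-1` [set n].
have DE : D = \bigcup_n F n.
  by apply/seteqP; split=> [x Dx|x [n _ []]//]; exists (c (Z x)).
have mg : measurable_fun D (fun x => g (Z x)) by exact: discrete_measurable_fun.
rewrite {1}DE ge0_integral_bigcup//; last 3 first.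
- by move=> n; apply: (discrete_comp c dZ).2.
- by rewrite -DE.
- by move=> i j _ _ [x [[_ /= <-] [_ /= <-]]].
pose a n := \int[mu]_(x in F n) g (Z x).
rewrite nneseries_esumT; last by move=> n; exact: integral_ge0.
have aA v : A v -> a (c v) = g v * mu (D `&` Z @^-1` [set v]).
  move=> Av; have -> : a (c v) = \int[mu]_(x in D `&` Z @^-1` [set v]) cst (g v) x.
    rewrite /a (_ : F (c v) = D `&` Z @^-1` [set v]); last first.
      apply/seteqP; split=> [x [Dx /= h]|x [Dx /= xv]]; split => //=.
        by apply: cinj => //; rewrite inE//; exact: ZA.
      by rewrite xv.
    by apply: eq_integral => x; rewrite inE => -[_ /= ->].
  exact: integral_cst.
transitivity (\esum_(n in c @` A) a n).
  rewrite [RHS]esum_mkcond; apply: eq_esum => n _; case: ifPn => // /negP nA.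
  rewrite (_ : F n = set0) ?integral_set0//.
  apply/seteqP; split=> // x [Dx /= h]; apply: nA; rewrite inE.
  by exists (Z x) => //; exact: ZA.
rewrite (esum_image A)//.
rewrite [LHS]esum_mkcond; apply: eq_esum => v _; case: ifPn => [|/negP nA].
  by rewrite inE => /aA.
rewrite (_ : _ `&` _ = set0) ?measure0 ?mule0//.
by apply/seteqP; split=> // x [Dx /= xv]; apply: nA; rewrite inE -xv; exact: ZA.
Qed.

(** Independence and equality of laws in one hypothesis: the joint law of [Z] and [Y] is the product
    of the laws of [Z] and of [Y']. In the application [Y'] is an initial block of quotients and [Y]
    the same block after some iterations of the map. *)
Lemma independent_integral {V W : choiceType} (Z : T -> V) (Y Y' : T -> W)
    (g : V -> \bar R) (h : W -> \bar R) :
  discrete_on Z -> discrete_on Y -> discrete_on Y' ->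
  (forall v, 0 <= g v) -> (forall w, 0 <= h w) ->
  (forall v w, mu (D `&` [set x | Z x = v /\ Y x = w]) =
     mu (D `&` Z @^-1` [set v]) * mu (D `&` Y' @^-1` [set w])) ->
  \int[mu]_(x in D) (g (Z x) * h (Y x)) =
    \int[mu]_(x in D) g (Z x) * \int[mu]_(x in D) h (Y' x).
Proof.
move=> dZ dY dY' g0 h0 indep.
have dZY := discrete_pair dZ dY.
rewrite (discrete_integral (g := fun vw => g vw.1 * h vw.2) dZY); last first.
  by move=> vw; exact: mule_ge0.
transitivity (\esum_(v in [set: V]) \esum_(w in [set: W])
    (g v * mu (D `&` Z @^-1` [set v]) * h w * mu (D `&` Y' @^-1` [set w]))).
  rewrite esum_esum; last by move=> *; rewrite !mule_ge0.
  rewrite (_ : _ `*`` _ = setT); last by apply/seteqP; split.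
  apply: eq_esum => -[v w] _ /=; rewrite (_ : _ `&` _ = D `&` [set x | Z x = v /\ Y x = w]).
    by rewrite indep muleACA muleA.
  by apply/seteqP; split=> [x [Dx [<- <-]]|x [Dx [/= -> ->]]].
under eq_esum => v _.
  rewrite -(discrete_integral
    (g := fun w => g v * mu (D `&` Z @^-1` [set v]) * h w) dY'); last first.
    by move=> w; rewrite !mule_ge0.
  rewrite ge0_integralZl ?mule_ge0//; last exact: (discrete_measurable_fun h dY').
  rewrite muleAC muleC.
  over.
set c := integral _ _ _.
have c0 : 0 <= c by exact: integral_ge0.
transitivity (\esum_(v in [set: V]) (c * g v * mu (D `&` Z @^-1` [set v]))).
  by apply: eq_esum => v _; rewrite muleC [g v * c]muleC.
rewrite -(discrete_integral (g := fun v => c * g v) dZ); last by move=> v; rewrite mule_ge0.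
rewrite (ge0_integralZl mu mD (discrete_measurable_fun g dZ) (fun _ _ => g0 _) c0).
exact: muleC.
Qed.

Lemma discrete_integral_pred {V : choiceType} (Z : T -> V) (b : pred V) :
  discrete_on Z -> \int[mu]_(x in D) ((b (Z x))%:R)%:E = mu (D `&` Z @^-1` [set v | b v]).
Proof.
move=> dZ; set A := D `&` _.
have mA : measurable A by exact: discrete_preimage.
transitivity (\int[mu]_(x in D) (\1_A x)%:E).
  apply: eq_integral => x; rewrite inE => Dx; rewrite indicE; congr (_%:R%:E).
  congr nat_of_bool; apply/idP/idP => [bx|]; first by rewrite inE.
  by rewrite inE => -[].
by rewrite integral_indic//; congr (mu _); apply: setIidl => x [].
Qed.

End DiscreteVariable.

(** * Moving averages of weakly stationary sequences *)

Section WeaklyStationary.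
Context {d : measure_display} {T : measurableType d} {R : realType}.
Variables (mu : {measure set T -> \bar R}) (D : set T).
Hypothesis mD : measurable D.
Hypothesis muD : mu D = 1%E.
Variables (y : nat -> T -> R) (k : nat) (M V : R).
Hypothesis y_ge0 : forall j x, 0 <= y j x.
Hypothesis my : forall j, measurable_fun D (y j).
Hypothesis y_mean : forall j, (\int[mu]_(x in D) (y j x)%:E = M%:E)%E.
Hypothesis y_moment2 : forall j, (\int[mu]_(x in D) (y j x ^+ 2)%:E = V%:E)%E.
Hypothesis y_uncorrelated : forall i j, (i + k <= j)%N ->
  (\int[mu]_(x in D) (y i x * y j x)%:E = (M ^+ 2)%:E)%E.

Lemma mean_ge0 : 0 <= M.
Proof. by rewrite -lee_fin -(y_mean 0) integral_ge0// => x _; rewrite lee_fin. Qed.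

Lemma moment2_ge0 : 0 <= V.
Proof.
by rewrite -lee_fin -(y_moment2 0) integral_ge0// => x _; rewrite lee_fin sqr_ge0.
Qed.

Let mprod i j : measurable_fun D (fun x => (y i x * y j x)%:E).
Proof. by apply/measurable_EFinP; exact: measurable_funM. Qed.

Lemma product_moment_le i j : (\int[mu]_(x in D) (y i x * y j x)%:E <= V%:E)%E.
Proof.
apply: (@le_trans _ _ (\int[mu]_(x in D) (2^-1%:E * ((y i x ^+ 2)%:E + (y j x ^+ 2)%:E)))%E).
  apply: ge0_le_integral => //.
  - by move=> x _; rewrite lee_fin mulr_ge0.
  - apply: measurable_funeM; apply: emeasurable_funD; apply/measurable_EFinP;
      exact: measurable_funX.
  - move=> x _; rewrite -EFinD -EFinM lee_fin.
    have := sqr_ge0 (y i x - y j x); lra.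
have msq l : measurable_fun D (fun x => (y l x ^+ 2)%:E).
  by apply/measurable_EFinP; exact: measurable_funX.
have ge l x : D x -> (0 <= (y l x ^+ 2)%:E)%E by move=> _; rewrite lee_fin sqr_ge0.
rewrite ge0_integralZl_EFin ?invr_ge0//; last 2 first.
- by move=> x Dx; rewrite adde_ge0 ?ge.
- exact: emeasurable_funD.
rewrite (ge0_integralD mu mD (ge i) (msq i) (ge j) (msq j)) !y_moment2.
by rewrite -EFinD -EFinM lee_fin; lra.
Qed.

Lemma product_moment_bound i j : (\int[mu]_(x in D) (y i x * y j x)%:E <=
  (M ^+ 2 + ((i < j + k)%N && (j < i + k)%N)%:R * V)%:E)%E.
Proof.
have V0 := moment2_ge0.
have [ij|ij] := leqP (i + k) j.
  by rewrite y_uncorrelated// lee_fin lerDl mulr_ge0.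
have [ji|ji] := leqP (j + k) i.
  under eq_integral do rewrite mulrC.
  by rewrite y_uncorrelated// lee_fin lerDl mulr_ge0.
apply: le_trans (product_moment_le i j) _.
by rewrite lee_fin mul1r lerDr sqr_ge0.
Qed.

Lemma near_diagonal_count u v i :
  (\sum_(u <= j < v) ((i < j + k)%N && (j < i + k)%N) <= k.*2)%N.
Proof.
rewrite (eq_bigr (fun j => if (i < j + k)%N && (j < i + k)%N then 1%N else 0%N)); last first.
  by move=> j _; case: ifP.
rewrite -big_mkcond sum1_count -size_filter -(size_iota (i.+1 - k) k.*2).
apply: uniq_leq_size; first by rewrite filter_uniq// iota_uniq.
by move=> j; rewrite mem_filter mem_iota; lia.
Qed.

(** When the square of the sum is expanded, each row has at most 2k pairs closer than k, each
    costing at most an extra V; all the other pairs contribute exactly M^2, which cancels against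
    the square of the mean. *)
Lemma block_variance (u m : nat) :
  (\int[mu]_(x in D) (((\sum_(u <= j < u + m) y j x) - m%:R * M) ^+ 2)%:E
    <= (m%:R * (k.*2%:R * V))%:E)%E.
Proof.
have M0 := mean_ge0; have V0 := moment2_ge0.
pose S x := \sum_(u <= j < u + m) y j x; pose c := m%:R * M.
have c0 : 0 <= c by rewrite mulr_ge0.
have S0 x : 0 <= S x by apply: sumr_ge0.
have mS : measurable_fun D S by apply: measurable_sum => j; exact: my.
have sum_eq l : (\sum_(u <= j < u + m) (fun=> l) j) = m%:R * l :> R.
  by rewrite sumr_const_nat addKn mulr_natl.
have ES : (\int[mu]_(x in D) (S x)%:E = c%:E)%E.
  under eq_integral do rewrite /S -sumEFin.
  rewrite ge0_integral_sum//; last 2 first.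
  - by move=> j; apply/measurable_EFinP; exact: my.
  - by move=> j x _; rewrite lee_fin.
  by rewrite (eq_bigr _ (fun j _ => y_mean j)) sumEFin sum_eq.
have ES2 : (\int[mu]_(x in D) ((S x) ^+ 2)%:E <= (c ^+ 2 + m%:R * (k.*2%:R * V))%:E)%E.
  under eq_integral do rewrite expr2 /S mulr_suml -sumEFin.
  rewrite ge0_integral_sum//; last 2 first.
  - move=> i; apply/measurable_EFinP; apply: measurable_funM => //.
  - by move=> i x _; rewrite lee_fin mulr_ge0// sumr_ge0.
  apply: (@le_trans _ _ (\sum_(u <= i < u + m)
      (\sum_(u <= j < u + m) (M ^+ 2 + ((i < j + k)%N && (j < i + k)%N)%:R * V))%:E)%E).
    apply: lee_sum => i _.
    under eq_integral do rewrite mulr_sumr -sumEFin.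
    rewrite ge0_integral_sum//; last first.
      by move=> j x _; rewrite lee_fin mulr_ge0.
    rewrite -sumEFin; apply: lee_sum => j _; exact: product_moment_bound.
  rewrite sumEFin lee_fin.
  under eq_bigr do rewrite big_split/= sum_eq -mulr_suml.
  rewrite big_split/= sum_eq -mulr_suml lerD//.
    by rewrite /c exprMn expr2 -mulrA.
  rewrite mulrA ler_wpM2r//.
  apply: le_trans (_ : \sum_(u <= i < u + m) (k.*2)%:R <= _); last first.
    by rewrite sum_eq.
  by apply: ler_sum => i _; rewrite -natr_sum ler_nat near_diagonal_count.
(* The expansion is integrated in the subtraction-free form (S - c)^2 + 2 c S = S^2 + c^2, so that
   only integrals of nonnegative functions occur. *)
have key : (\int[mu]_(x in D) ((S x - c) ^+ 2)%:E + ((2 * c) * c)%:E =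
            \int[mu]_(x in D) ((S x) ^+ 2)%:E + (c ^+ 2)%:E)%E.
  have mE (g : T -> R) : measurable_fun D g -> measurable_fun D (EFin \o g).
    by move=> mg; apply/measurable_EFinP.
  rewrite {1}EFinM -{1}ES -(ge0_integralZl_EFin mu mD (f1 := EFin \o S)); last 3 first.
  - by move=> x _; rewrite lee_fin.
  - exact: mE.
  - by rewrite mulr_ge0.
  rewrite -[(c ^+ 2)%:E]mule1 -muD -(integral_cst mu mD).
  rewrite -ge0_integralD//; last 4 first.
  - by move=> x _; rewrite lee_fin sqr_ge0.
  - by apply: mE; apply: measurable_funX; exact: measurable_funB.
  - by move=> x _; rewrite mule_ge0// lee_fin// mulr_ge0.
  - by apply: measurable_funeM; exact: mE.
  rewrite -ge0_integralD//; last 3 first.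
  - by move=> x _; rewrite lee_fin sqr_ge0.
  - by apply: mE; exact: measurable_funX.
  - by move=> x _; rewrite lee_fin sqr_ge0.
  by apply: eq_integral => x _; rewrite -EFinM -!EFinD; congr EFin; rewrite -/c; ring.
rewrite -(leeD2rE (x := ((2 * c) * c)%:E))// key.
apply: (le_trans (leeD2r _ ES2)).
by rewrite -!EFinD lee_fin; lra.
Qed.

End WeaklyStationary.

(** * Almost sure convergence along blocks and windows *)

Lemma ae_cvg0_summable {d : measure_display} {T : measurableType d} {R : realType}
    (mu : {measure set T -> \bar R}) (D : set T) (g : nat -> T -> R) :
  measurable D -> (forall n x, 0 <= g n x) -> (forall n, measurable_fun D (g n)) ->
  (\sum_(n <oo) \int[mu]_(x in D) (g n x)%:E < +oo)%E ->
  {ae mu, forall x, D x -> (fun n => g n x) @ \oo --> (0 : R)}.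
Proof.
move=> mD g0 mg gfin.
have g0E n x : (0 <= (g n x)%:E)%E by rewrite lee_fin.
have mgE n : measurable_fun D (fun x => (g n x)%:E) by exact/measurable_EFinP.
(* Sum and integral may be exchanged, so the series is integrable, hence finite almost everywhere;
   where it is finite, each term is squeezed under a vanishing tail. *)
have : mu.-integrable D (fun x => \sum_(n <oo) (g n x)%:E)%E.
  apply/integrableP; split; first exact: ge0_emeasurable_sum.
  under eq_integral do rewrite gee0_abs ?nneseries_ge0//.
  by rewrite integral_nneseries.
move=> /(integrable_ae mD); apply: filterS => x hx Dx.
have {}hx : (\sum_(n <oo) (g n x)%:E < +oo)%E.
  by rewrite -ge0_fin_numE ?hx// nneseries_ge0.
have tail := nneseries_tail_cvg hx (fun n _ => g0E n x).
suff : (fun n => (g n x)%:E) @ \oo --> (0 : R)%:E by move=> /fine_cvg.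
apply: (@squeeze_cvge _ _ _ _ (cst 0%E) _ (fun N => \sum_(N <= k <oo) (g k x)%:E)%E) => //.
  near=> n; rewrite g0E/= (nneseries_split _ 1)// addn1 big_nat1 leeDl//.
  by rewrite nneseries_ge0.
exact: cvg_cst.
Unshelve. all: by end_near. Qed.

Lemma sum_nat_blocks {V : nmodType} (u : nat -> V) (m r0 r1 : nat) : (r0 <= r1)%N ->
  \sum_(r0 * m <= j < r1 * m) u j =
  \sum_(r0 <= r < r1) \sum_(r * m <= j < r * m + m) u j.
Proof.
move=> /subnK <-; elim: (r1 - r0)%N => [|n ih]; first by rewrite add0n !big_geq.
rewrite addSn big_nat_recr ?leq_addl//= -ih.
rewrite (big_cat_nat (n := ((n + r0) * m)%N)) ?leq_mul2r ?leq_addl ?leqnSn ?orbT//=.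
by rewrite mulSn [(m + _)%N]addnC.
Qed.

(* The window is sandwiched between the union of the blocks that it meets and
   the union of all of these but the two extreme ones. *)
Lemma window_sum_bound {R : realType} (u : nat -> R) (m a b : nat) (M delta : R) :
  (0 < m)%N -> (0 < b)%N -> (forall j, 0 <= u j) -> 0 <= M -> 0 <= delta ->
  (forall r, (a %/ m <= r <= (a + b).-1 %/ m)%N ->
     `|(\sum_(r * m <= j < r * m + m) u j) - m%:R * M| <= m%:R * delta) ->
  `|(\sum_(a <= j < a + b) u j) - b%:R * M| <= b%:R * delta + (2 * m)%:R * (M + delta).
Proof.
move=> m0 b0 u0 M0 d0 blk.
set r0 := (a %/ m)%N; set r1 := ((a + b).-1 %/ m)%N.
have r01 : (r0 <= r1)%N by apply: leq_div2r; lia.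
have ar0 : (r0 * m <= a < r0 * m + m)%N.
  by rewrite leq_trunc_div [(r0 * m + m)%N]addnC -mulSn ltn_ceil.
have ar1 : (r1 * m <= (a + b).-1 < r1 * m + m)%N.
  by rewrite leq_trunc_div [(r1 * m + m)%N]addnC -mulSn ltn_ceil.
have sub (c1 c2 c3 c4 : nat) : (c1 <= c2)%N -> (c3 <= c4)%N ->
    \sum_(c2 <= j < c3) u j <= \sum_(c1 <= j < c4) u j.
  move=> c12 c34; have [c23|c32] := leqP c2 c3; last first.
    by rewrite big_geq ?(ltnW c32)// sumr_ge0.
  rewrite (big_cat_nat (n := c2) (p := c4))//=; last exact: leq_trans c34.
  rewrite (big_cat_nat (n := c3) (p := c4))//= addrCA lerDl.
  by rewrite addr_ge0// sumr_ge0.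
have mR : 0 <= m%:R :> R by [].
have bR : 0 <= b%:R :> R by [].
rewrite ler_norml; apply/andP; split; last first.
  have up : \sum_(a <= j < a + b) u j <= \sum_(r0 * m <= j < r1.+1 * m) u j.
    by apply: sub; rewrite ?mulSn; lia.
  rewrite sum_nat_blocks ?(leqW r01)// in up.
  have {}up : \sum_(a <= j < a + b) u j <= (r1.+1 - r0)%:R * (m%:R * (M + delta)).
    apply: (le_trans up); rewrite mulr_natl -sumr_const_nat big_nat [leRHS]big_nat.
    apply: ler_sum => r /andP[rr0 rr1].
    have := blk r; rewrite -/r0 -/r1 rr0 -ltnS rr1 => /(_ isT).
    by rewrite ler_norml => /andP[_]; lra.
  have cnt : ((r1.+1 - r0) * m <= b + 2 * m)%N by rewrite mulnBl mulSn; lia.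
  have : (r1.+1 - r0)%:R * m%:R <= b%:R + (2 * m)%:R :> R by rewrite -natrM -natrD ler_nat.
  have : 0 <= M + delta by rewrite addr_ge0.
  by move: up; rewrite mulrA; nra.
have low : \sum_(r0.+1 * m <= j < r1 * m) u j <= \sum_(a <= j < a + b) u j.
  by apply: sub; rewrite ?mulSn; lia.
have S0 : 0 <= \sum_(a <= j < a + b) u j by rewrite sumr_ge0.
have m2 : 0 <= (2 * m)%:R * (M + delta) by rewrite mulr_ge0// addr_ge0.
(* If M <= delta, nonnegativity of the sum already gives the lower bound; otherwise M - delta > 0
   and the blocks inside the window can be counted. *)
have [Md|dM] := leP M delta; first by nra.
have cnt : (b <= (r1 - r0.+1) * m + 2 * m)%N by rewrite mulnBl mulSn; lia.
have {}low : (r1 - r0.+1)%:R * (m%:R * (M - delta)) <= \sum_(a <= j < a + b) u j.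
  have [r1r0|r0r1] := ltnP r1 r0.+1.
    by rewrite (_ : (r1 - r0.+1)%N = 0%N) ?mul0r//; lia.
  apply: (le_trans _ low); rewrite sum_nat_blocks// mulr_natl -sumr_const_nat.
  rewrite big_nat [leRHS]big_nat; apply: ler_sum => r /andP[rr0 rr1].
  have := blk r; rewrite -/r0 -/r1 (ltnW rr0) (ltnW rr1) => /(_ isT).
  by rewrite ler_norml => /andP[+ _]; lra.
have : b%:R <= (r1 - r0.+1)%:R * m%:R + (2 * m)%:R :> R by rewrite -natrM -natrD ler_nat.
have : 0 <= (2 * m)%:R :> R by [].
have : 0 < M - delta by rewrite subr_gt0.
by move: low; rewrite mulrA; nra.
Qed.

(* At a height proportional to 16^s, the cone over a window of length about 16^s
   contains all the blocks of length 8^s that the window meets. *)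
Lemma stoltz_blocks (R : realType) (a b : nat -> nat) : stoltz R a b ->
  (fun n => (b n)%:R : R) @ \oo --> +oo /\
  exists (C : R) (s0 : nat) (G : nat -> seq nat),
    [/\ 0 <= C,
        forall s, (size (G s))%:R * 8 ^+ s <= C * 16 ^+ s &
        forall s n, (s0 <= s)%N -> (0 < n)%N -> (16 ^ s <= b n < 16 ^ s.+1)%N ->
          forall r, (a n %/ 8 ^ s <= r <= (a n + b n).-1 %/ 8 ^ s)%N -> r \in G s].
Proof.
move=> [W [_ _ [h [h0 hoo hab]] [l [kappa [A [l0 kappa0 A0 slice]]]]]].
split.
  apply/cvgryPge => B; have /cvgryPge/(_ B) hB := hoo.
  near=> n; apply: (le_trans (_ : B <= h n)); first by near: n.
  have n0 : (0 < n)%N by near: n; exact: nbhs_infty_gt.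
  by have [_ /=] := hab n n n0 (leqnn n).
(* Chosen so that kappa (Lam - 16) > 32. At height Lam 16^s, which exceeds b_n by more than (Lam -
   16) 16^s, the cone over (a_n, b_n) then reaches beyond distance 2 * 16^(s+1) from a_n. *)
pose Lam := (17 + Num.truncn (32 / kappa))%N.
pose lam s := (Lam * 16 ^ s)%N.
have lam0 s : (0 < lam s)%N by rewrite muln_gt0 expn_gt0.
pose S s := fset_set (stoltz_slice W l kappa (lam s)).
have Sfin s : finite_set (stoltz_slice W l kappa (lam s)) := (slice _ (lam0 s)).1.
pose pos s (r t : nat) : int := (r * 8 ^ s + t)%N%:Z.
(* Only blocks contained in the slice are kept: being disjoint, they are at most #S / 8^s in
   number. *)
pose G s := [seq r <- undup [seq (`|z| %/ 8 ^ s)%N | z <- S s] |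
              all (fun t => pos s r t \in S s) (iota 0 (8 ^ s))].
have e8 s : (0 < 8 ^ s)%N by rewrite expn_gt0.
(* The threshold exceeds l: for s beyond it, l < s <= 16^s <= b_n or l < s0 = s, so (a_n, b_n) is in
   the level l of [W]. *)
exists (A * Lam%:R), (Num.truncn l).+1, G; split.
- by rewrite mulr_ge0// ltW.
- move=> s; have [_ hS] := slice _ (lam0 s).
  rewrite -mulrA -natrX -natrM -[16]/(16%:R) -natrX -natrM.
  apply: le_trans hS; rewrite ler_nat.
  pose P := [seq pos s r t | r <- G s, t <- iota 0 (8 ^ s)].
  have -> : (size (G s) * 8 ^ s = size P)%N by rewrite size_allpairs size_iota.
  apply: uniq_leq_size.
    apply: allpairs_uniq; rewrite ?iota_uniq ?filter_uniq ?undup_uniq//.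
    move=> _ _ /allpairsP[[r t] [_ + ->]] /allpairsP[[r' t'] [_ + ->]] /=.
    rewrite !mem_iota => /andP[_ t8] /andP[_ t8'].
    rewrite /pos => -[] rt.
    have rr : r = r'.
      have := congr1 (divn^~ (8 ^ s)%N) rt.
      by rewrite /= !divnMDl// !divn_small ?addn0//; lia.
    by rewrite rr in rt *; congr (_, _); move/addnI: rt.
  move=> z /allpairsP[[r t] /= [rG tI ->]].
  by move: rG; rewrite mem_filter => /andP[/allP/(_ t tI)].
- move=> s n ls n0 /andP[b1 b2] r /andP[r1 r2].
  have Ow : stoltz_level W l ((a n)%:Z, b n).
    split; first by have [] := hab 1%N n isT n0.
    rewrite /=; apply: (le_trans (y := (16 ^ s)%:R)); last by rewrite ler_nat.
    apply: (le_trans (y := s%:R)); last by rewrite ler_nat ltnW// ltn_expl.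
    by apply: (le_trans (ltW (truncnS_gt l))); rewrite ler_nat.
  have inS t : (t < 8 ^ s)%N -> pos s r t \in S s.
    move=> t8; rewrite in_fset_set// inE /stoltz_slice/=.
    exists ((a n)%:Z, b n) => //=.
    have : `|pos s r t - (a n)%:Z| <= (2 * 16 ^ s.+1)%N%:Z.
      have h1 : (a n < r * 8 ^ s + 8 ^ s)%N.
        by apply: (leq_trans (ltn_ceil (a n) (e8 s))); rewrite addnC -mulSn leq_mul2r ltnS r1 orbT.
      have h2 : (r * 8 ^ s <= (a n + b n).-1)%N.
        by apply: leq_trans (leq_trunc_div _ (8 ^ s)); rewrite leq_mul2r r2 orbT.
      have h3 : (8 ^ s <= 16 ^ s)%N by case: (s) => // s'; rewrite leq_exp2r.
      move: h1 h2 h3 t8 b2; rewrite /pos expnS; move: (r * 8 ^ s)%N (8 ^ s)%N (16 ^ s)%N.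
      by move=> u v w; lia.
    rewrite -(ler_int R) intr_norm => /le_lt_trans; apply.
    have k32 : 32 < kappa * (Lam%:R - 16).
      rewrite mulrC -ltr_pdivrMr// /Lam natrD.
      have := truncnS_gt (32 / kappa); rewrite -natr1; lra.
    have bn : (b n)%:R <= (16 ^ s.+1)%:R :> R by rewrite ler_nat ltnW.
    rewrite rmorphB/= -!pmulrn /lam natrM.
    rewrite expnS natrM in bn.
    have e16 : 0 < (16 ^ s)%:R :> R by rewrite ltr0n expn_gt0.
    rewrite natrM expnS natrM.
    apply: (lt_le_trans (y := kappa * (Lam%:R - 16) * (16 ^ s)%:R)); first by nra.
    by rewrite -mulrA ler_pM2l//; lra.
  rewrite mem_filter; apply/andP; split.
    by apply/allP => t; rewrite mem_iota => /andP[_]; exact: inS.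
  rewrite mem_undup; apply/mapP; exists (pos s r 0); first exact: inS.
  by rewrite /pos/= addn0 mulnK.
Unshelve. all: by end_near. Qed.

Lemma moving_average {d : measure_display} {T : measurableType d} {R : realType}
    (mu : {measure set T -> \bar R}) (D : set T) (y : nat -> T -> R) (k : nat) (M V : R)
    (a b : nat -> nat) :
  measurable D -> mu D = 1%E ->
  (forall j x, 0 <= y j x) -> (forall j, measurable_fun D (y j)) ->
  (forall j, (\int[mu]_(x in D) (y j x)%:E = M%:E)%E) ->
  (forall j, (\int[mu]_(x in D) (y j x ^+ 2)%:E = V%:E)%E) ->
  (forall i j, (i + k <= j)%N ->
    (\int[mu]_(x in D) (y i x * y j x)%:E = (M ^+ 2)%:E)%E) ->
  stoltz R a b ->
  {ae mu, forall x, D x ->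
    (fun n => (b n)%:R^-1 * \sum_(a n <= j < a n + b n) y j x) @ \oo --> M}.
Proof.
move=> mD muD y0 my y_mean y_mom y_unc /stoltz_blocks[boo [C [s0 [G [C0 sizeG inG]]]]].
have M0 : 0 <= M := mean_ge0 y0 y_mean.
have V0 : 0 <= V := moment2_ge0 y_mom.
pose m s := (8 ^ s)%N.
have m0 s : (0 < m s)%N by rewrite expn_gt0.
have mR s : 0 < (m s)%:R :> R by rewrite ltr0n.
pose dev s r x : R := (\sum_(r * m s <= j < r * m s + m s) y j x) - (m s)%:R * M.
(* One function per scale: the square root of [g s x] bounds the error of all block averages in
   [G s] at once, which gives the uniformity. *)
pose g s x : R := \sum_(r <- G s) (m s)%:R ^- 2 * dev s r x ^+ 2.
have mdev s r : measurable_fun D (dev s r).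
  by apply: measurable_funB => //; apply: measurable_sum => j; exact: my.
have mterm s r : measurable_fun D (fun x => (m s)%:R ^- 2 * dev s r x ^+ 2).
  by apply: measurable_funM => //; exact: measurable_funX.
have term0 s r x : 0 <= (m s)%:R ^- 2 * dev s r x ^+ 2.
  by rewrite mulr_ge0 ?sqr_ge0// invr_ge0 exprn_ge0.
have mg s : measurable_fun D (g s) by apply: measurable_sum => r; exact: mterm.
have g0 s x : 0 <= g s x by apply: sumr_ge0.
pose W := C * (k.*2%:R * V).
have W0 : 0 <= W by rewrite !mulr_ge0.
have int_g s : (\int[mu]_(x in D) (g s x)%:E <= (W * 4 ^- s)%:E)%E.
  under eq_integral do rewrite /g -sumEFin.
  rewrite ge0_integral_sum//; last 2 first.
  - by move=> r; apply/measurable_EFinP.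
  - by move=> r x _; rewrite lee_fin.
  apply: (@le_trans _ _ (\sum_(r <- G s) ((m s)%:R^-1 * (k.*2%:R * V))%:E)%E).
    apply: lee_sum => r _; under eq_integral do rewrite EFinM.
    rewrite ge0_integralZl_EFin//; last 2 first.
    - by move=> x _; rewrite lee_fin sqr_ge0.
    - by apply/measurable_EFinP; exact: measurable_funX.
    have m2 : (0 <= ((m s)%:R ^- 2)%:E :> \bar R)%E.
      by rewrite lee_fin invr_ge0 exprn_ge0.
    have bv := block_variance mD muD y0 my y_mean y_mom y_unc (r * m s) (m s).
    apply: (le_trans (lee_wpmul2l m2 bv)); rewrite -EFinM lee_fin.
    rewrite [leLHS]mulrA (_ : (m s)%:R ^- 2 * (m s)%:R = (m s)%:R^-1)//.
    by rewrite expr2 invfM mulfVK// gt_eqF.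
  rewrite sumEFin lee_fin big_const_seq count_predT iter_addr_0 -[leLHS]mulr_natl.
  rewrite [leLHS]mulrA /W [leRHS]mulrAC ler_wpM2r ?mulr_ge0//.
  rewrite ler_pdivrMr// -(ler_pM2r (mR s)) /m natrX.
  apply: (le_trans (sizeG s)); rewrite -!mulrA ler_wpM2l//.
  rewrite -!exprMn_comm ?commr_refl//; try exact: mulrC.
  rewrite -exprVn -!exprMn (_ : 4^-1 * (8 * 8) = 16 :> R)//; lra.
have gsum : (\sum_(s <oo) \int[mu]_(x in D) (g s x)%:E < +oo)%E.
  apply: (@le_lt_trans _ _ (W * 2)%:E); last by rewrite ltry.
  apply: lime_le.
    apply: is_cvg_nneseries => s _ _; apply: integral_ge0 => x _; exact: g0.
  near=> n; apply: (le_trans (lee_sum _ (fun s _ => int_g s))).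
  rewrite sumEFin lee_fin -mulr_sumr ler_wpM2l//.
  (* The limit is 4/3; the rougher constant 2 suffices, and the subtracted term lets the induction
     close. *)
  have : \sum_(0 <= s < n) 4 ^- s <= 2 - 2 * 4 ^- n :> R.
    elim: (n) => [|n' ih]; first by rewrite big_nil expr0; lra.
    rewrite big_nat_recr//= exprS invfM.
    have : 0 <= 4 ^- n' :> R by rewrite invr_ge0 exprn_ge0.
    by lra.
  have : 0 <= 4 ^- n :> R by rewrite invr_ge0 exprn_ge0.
  by lra.
apply: filterS (ae_cvg0_summable mD g0 mg gsum) => x gx Dx.
have {}gx := gx Dx.
pose delta s := Num.sqrt (g s x).
have delta_cvg : delta @ \oo --> (0 : R).
  by rewrite -sqrtr0; apply: continuous_cvg => //; exact: sqrt_continuous.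
(* The bound of [window_sum_bound] divided by the length of the window: the boundary term has
   relative weight at most 2 * 8^s / 16^s. *)
pose eta s := delta s + 2 * (2^-1 ^+ s * (M + delta s)).
have eta_cvg : eta @ \oo --> (0 : R).
  rewrite (_ : 0 = 0 + 2 * (0 * (M + 0)) :> R); last by rewrite mul0r mulr0 addr0.
  apply: cvgD => //; apply: cvgM; first exact: cvg_cst.
  apply: cvgM; last by apply: cvgD => //; exact: cvg_cst.
  have := @cvg_geometric R 1 2^-1; rewrite /geometric/=.
  under eq_fun do rewrite mul1r.
  by apply; rewrite ger0_norm; lra.
pose s n := trunc_log 16 (b n).
have s_cvg : s @ \oo --> \oo.
  apply/cvgnyPge => A; have /cvgryPge/(_ (16 ^ A)%:R) := boo.
  apply: filterS => n; rewrite ler_nat => An.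
  have : (16 ^ A < 16 ^ (s n).+1)%N by apply: leq_ltn_trans An (trunc_log_ltn _ _).
  by rewrite ltn_exp2l.
have main : \forall n \near \oo,
    `|(b n)%:R^-1 * (\sum_(a n <= j < a n + b n) y j x) - M| <= eta (s n).
  near=> n.
  have n0 : (0 < n)%N by near: n; exact: nbhs_infty_gt.
  have b0 : (0 < b n)%N.
    rewrite -(ltr0n R); apply: (@lt_le_trans _ _ 1) => //.
    by near: n; move/cvgryPge : boo; apply.
  have s0n : (s0 <= s n)%N by near: n; move/cvgnyPge : s_cvg; apply.
  have b16 : (16 ^ s n <= b n < 16 ^ (s n).+1)%N.
    by rewrite trunc_logP// trunc_log_ltn.
  have := @window_sum_bound R (y ^~ x) (m (s n)) (a n) (b n) M (delta (s n)) (m0 _) b0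
    (fun j => y0 j x) M0 (sqrtr_ge0 _).
  have blk r : (a n %/ m (s n) <= r <= (a n + b n).-1 %/ m (s n))%N ->
      `|dev (s n) r x| <= (m (s n))%:R * delta (s n).
    move=> /(inG _ _ s0n n0 b16) rG.
    rewrite -sqrtr_sqr -[leRHS]ger0_norm ?mulr_ge0 ?sqrtr_ge0// -sqrtr_sqr.
    rewrite ler_wsqrtr// exprMn sqr_sqrtr//.
    rewrite -ler_pdivrMl ?exprn_gt0// /g (big_rem r)//= lerDl.
    by apply: sumr_ge0 => r' _.
  move=> /(_ blk) wb.
  have bR : 0 < (b n)%:R :> R by rewrite ltr0n.
  have -> : (b n)%:R^-1 * (\sum_(a n <= j < a n + b n) y j x) - M =
      (b n)%:R^-1 * ((\sum_(a n <= j < a n + b n) y j x) - (b n)%:R * M).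
    by rewrite mulrBr mulKf// gt_eqF.
  rewrite normrM ger0_norm ?invr_ge0// mulrC ler_pdivrMr//.
  apply: (le_trans wb); rewrite /eta natrM.
  have /andP[b16' _] := b16.
  have mb : (m (s n))%:R <= 2^-1 ^+ s n * (b n)%:R :> R.
    apply: (le_trans (y := 2^-1 ^+ s n * (16 ^ s n)%:R)); last first.
      by rewrite ler_wpM2l ?exprn_ge0 ?invr_ge0// ler_nat.
    by rewrite !natrX -exprMn (_ : 2^-1 * 16%:R = 8%:R :> R)//; lra.
  have X0 : 0 <= M + delta (s n) by rewrite addr_ge0// sqrtr_ge0.
  move: mb X0; move: (2^-1 ^+ s n) (delta (s n)) (m (s n))%:R (b n)%:R => h e q B mb X0.
  have := mulr_ge0 X0 (_ : 0 <= h * B - q); rewrite subr_ge0 => /(_ mb).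
  by rewrite -[2%:R]/(2 : R); nra.
apply/subr_cvg0; apply: (@squeeze_cvgr _ _ _ _ (fun n => - eta (s n)) (fun n => eta (s n))).
- by apply: filterS main => n; rewrite ler_norml.
- by rewrite -oppr0; apply: cvgN; exact: cvg_comp s_cvg eta_cvg.
- exact: cvg_comp s_cvg eta_cvg.
Unshelve. all: by end_near. Qed.

(** * Cylinders of the continued fraction map *)

Section Cylinders.
Variables (R : realType) (K : fieldType) (absK : K -> R).
Variables (rho : R) (varpi : K) (q : nat) (digit : nat -> K) (fl : K -> K).
Variable (mu : {measure set (borel_space absK) -> \bar R}).
Hypothesis av : absolute_value absK.
Hypothesis na : forall n : nat, absK n%:R <= 1.
Hypothesis rho_gt1 : 1 < rho.
Hypothesis absE : forall x, x != 0 -> exists z : int, absK x = rho ^ z.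
Hypothesis abs_varpi : absK varpi = rho^-1.
Hypothesis q_gt1 : (1 < q)%N.
Hypothesis digit_inj : forall i j, (i < q)%N -> (j < q)%N ->
  absK (digit i - digit j) < 1 -> i = j.
Hypothesis digit_le1 : forall i, absK (digit i) <= 1.
Hypothesis digit_ex : forall x, absK x <= 1 ->
  exists2 i, (i < q)%N & absK (x - digit i) < 1.
Hypothesis fl_lt1 : forall x, absK (x - fl x) < 1.
Hypothesis fl_eq : forall x y, absK (x - y) < 1 -> fl x = fl y.
Hypothesis fl_countable : countable (range fl).
Hypothesis haar : haar_measure mu.
Hypothesis mu_ball1 : mu (unit_ball absK) = 1%E.

Let rho_gt0 : 0 < rho.
Proof. exact: lt_trans rho_gt1. Qed.

Let rho_neq0 : rho != 0.
Proof. by rewrite gt_eqF. Qed.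

Let rhoX_gt0 n : 0 < rho ^+ n.
Proof. by rewrite exprn_gt0. Qed.

Let q_gt0 : 0 < q%:R :> R.
Proof. by rewrite ltr0n ltnW. Qed.

Lemma rhoN_le (m n : nat) : (m <= n)%N -> rho ^- n <= rho ^- m.
Proof. by move=> mn; rewrite lef_pV2 ?posrE// ler_eXn2l. Qed.

Definition cball (y : K) (n : nat) : set (borel_space absK) :=
  [set x : K | absK (x - y) < rho ^- n].

Lemma cball0 : cball 0 0 = unit_ball absK.
Proof. by apply/seteqP; split=> x; rewrite /cball/unit_ball/= subr0 expr0 invr1. Qed.

Lemma measurable_cball y n : measurable (cball y n).
Proof.
have : abs_open (cball y n : set (abs_space absK)).
  move=> x xy; exists (rho ^- n); first by rewrite invr_gt0.
  by move=> z zx; exact: (absvB_lt av na) zx xy.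
exact: sub_sigma_algebra.
Qed.

Let measurable_unit_ball : measurable (unit_ball absK).
Proof. by rewrite -cball0; exact: measurable_cball. Qed.

Lemma mu_cball_translate y n : mu (cball y n) = mu (cball 0 n).
Proof.
rewrite -(haar_translation haar y (measurable_cball 0 n)); congr (mu _).
apply/seteqP; split=> [x xy|_ [z zn <-]]; last first.
  by move: zn; rewrite /cball/= subr0 addrAC subrr add0r.
exists (x - y : K); last exact: subrKC.
by move: xy; rewrite /cball/= subr0.
Qed.


Lemma absK_ltX (x : K) (n : nat) : absK x < rho ^- n -> absK x <= rho ^- n.+1.
Proof.
have [->|x0] := eqVneq x 0; first by rewrite (absv0 av) invr_ge0 ltW.
have [z ->] := absE x0; rewrite !exprnN ltr_eXz2l// ler_eXz2l//; lia.
Qed.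

(** By discreteness the ball consists of the x with |x| <= rho^(-(n+1)); divided by varpi^(n+1) they
    become integral and are sorted by residue class. *)
Lemma cball_split (n : nat) :
  cball 0 n = \bigcup_(i in `I_q) cball (varpi ^+ n.+1 * digit i) n.+1.
Proof.
have vp : absK (varpi ^+ n.+1) = rho ^- n.+1 by rewrite (absvX av) abs_varpi exprVn.
have v0 : varpi ^+ n.+1 != 0 by rewrite -(absv_gt0 av) vp invr_gt0.
have nn : rho ^- n.+1 < rho ^- n by rewrite ltf_pV2 ?posrE// ltr_eXn2l.
apply/seteqP; split=> [x|x [i iq]]; rewrite /cball/= subr0 => xn; last first.
  rewrite -(subrK (varpi ^+ n.+1 * digit i) x); apply: (absv_ultra_lt av na).
    exact: lt_trans xn nn.
  rewrite (absvM av) vp (le_lt_trans _ nn)// ler_piMr// invr_ge0 ltW//.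
have /digit_ex[i iq xi] : absK (x / varpi ^+ n.+1) <= 1.
  by rewrite (absvM av) (absvV av) vp invrK -ler_pdivlMr// mul1r absK_ltX.
exists i => //; rewrite /cball/=.
have -> : x - varpi ^+ n.+1 * digit i = (x / varpi ^+ n.+1 - digit i) * varpi ^+ n.+1.
  by rewrite mulrBl divfK// [_ * digit i]mulrC.
by rewrite (absvM av) vp gtr_pMl// invr_gt0.
Qed.

(** Each ball is a disjoint union of q translates of the next smaller one, and translation
    invariance gives these equal shares. *)
Lemma mu_cball y n : mu (cball y n) = (q%:R ^- n)%:E.
Proof.
rewrite mu_cball_translate; elim: n => [|n ih].
  by rewrite cball0 mu_ball1 expr0 invr1.
have vp : absK (varpi ^+ n.+1) = rho ^- n.+1 by rewrite (absvX av) abs_varpi exprVn.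
have := ih; rewrite cball_split measure_fin_bigcup//; last 2 first.
- move=> i j iq jq [x [xi xj]]; apply: digit_inj => //.
  have := absvB_lt av na; rewrite /cball/= in xi xj; rewrite (absvB av) in xi.
  move=> /(_ _ _ _ _ xi xj); rewrite -mulrBr (absvM av) vp.
  by rewrite gtr_pMr// invr_gt0.
- by move=> i _; exact: measurable_cball.
rewrite -fsbig_ord (eq_bigr (fun=> mu (cball 0 n.+1))); last first.
  by move=> i _; exact: mu_cball_translate.
have [r ->] : exists r, mu (cball 0 n.+1) = r%:E.
  have le : (mu (cball 0 n.+1) <= mu (cball 0 n))%E.
    apply: le_measure; rewrite ?inE; [exact: measurable_cball..|].
    by move=> x; rewrite /cball/= => /lt_le_trans; apply; exact: rhoN_le.
  exists (fine (mu (cball 0 n.+1))); rewrite fineK// ge0_fin_numE//.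
  by rewrite (le_lt_trans le)// ih ltry.
rewrite sumEFin sumr_const card_ord => -[h]; congr EFin.
by rewrite exprS invfM -h -(mulr_natl r) mulKf// gt_eqF.
Qed.

(** The form of the exceptional cylinders: [subsingletonP] yields their measurability as well as
    their nullity. *)
Let subsingleton (S : set (borel_space absK)) := forall x x' : K, S x -> S x' -> x = x'.

Let measurable_point (x : K) : measurable ([set x] : set (borel_space absK)).
Proof.
rewrite (_ : [set x] = \bigcap_n cball x n).
  by apply: bigcapT_measurable => n; exact: measurable_cball.
apply/seteqP; split=> [_ -> n _|y xy]; rewrite /cball/=.
  by rewrite subrr (absv0 av) invr_gt0.
apply/eqP; rewrite -subr_eq0; apply/negPn/negP => h.
have {}h : 0 < absK (y - x) by rewrite (absv_gt0 av).
have [n hn] := exprn_unbounded (absK (y - x))^-1 rho_gt1.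
have := xy n I; rewrite /cball/= ltNge => /negP; apply.
by rewrite -[leRHS]invrK lef_pV2 ?posrE ?invr_gt0// ltW.
Qed.

Let mu_point (x : K) : mu [set x] = 0%E.
Proof.
apply/eqP; rewrite eq_le measure_ge0 andbT; apply/lee_addgt0Pr => r r0.
have q1 : 1 < q%:R :> R by rewrite ltr1n.
have [n hn] := exprn_unbounded r^-1 q1.
rewrite add0e; apply: (le_trans (y := mu (cball x n))).
  apply: le_measure; rewrite ?inE; [exact: measurable_point|exact: measurable_cball|].
  by move=> _ ->; rewrite /cball/= subrr (absv0 av) invr_gt0.
rewrite mu_cball lee_fin -[leRHS]invrK lef_pV2 ?posrE ?invr_gt0 ?exprn_gt0//.
exact: ltW.
Qed.

Let subsingletonP (S : set (borel_space absK)) :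
  subsingleton S -> measurable S /\ mu S = 0%E.
Proof.
move=> S1; have [->|/set0P[x Sx]] := eqVneq S set0.
  by split; [exact: measurable0 | exact: measure0].
rewrite (_ : S = [set x]); first by split; [exact: measurable_point | exact: mu_point].
by apply/seteqP; split=> [y Sy|_ ->//]; exact: S1.
Qed.

(** * Words of quotients and the measures of their cylinders *)

Definition fl_map (x : K) : K := if x == 0 then 0 else x^-1 - fl x^-1.

Definition fl_quotients (n : nat) (x : borel_space absK) : seq K :=
  mkseq (fun j => fl (iter j fl_map (x : K))^-1) n.

Local Notation B := (unit_ball absK).

Lemma fl_map_ball (x : K) : B (fl_map x).
Proof.
by rewrite /unit_ball/= /fl_map; case: eqP => _; rewrite ?(absv0 av).
Qed.

Lemma fl_quotientsD m n (x : K) :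
  fl_quotients (m + n) x = fl_quotients m x ++ fl_quotients n (iter m fl_map x).
Proof.
rewrite /fl_quotients /mkseq iotaD map_cat; congr (_ ++ _).
rewrite -[X in map _ (iota X n)]addn0 iotaDl -map_comp; apply: eq_map => j /=.
by rewrite addnC iterD.
Qed.

Lemma fl_quotientsS n (x : K) :
  fl_quotients n.+1 x = fl x^-1 :: fl_quotients n (fl_map x).
Proof. exact: (fl_quotientsD 1). Qed.

Definition cylinder (s : seq K) : set (borel_space absK) :=
  B `&` [set x | fl_quotients (size s) x = s].

Lemma cylinder_cons c s :
  cylinder (c :: s) = B `&` [set x : K | fl x^-1 = c /\ cylinder s (fl_map x)].
Proof.
apply/seteqP; split=> x; rewrite /cylinder/=.
  move=> [Bx]; rewrite fl_quotientsS => -[xc xs]; split=> //; split=> //.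
  by split=> //; exact: fl_map_ball.
by move=> [Bx [xc [_ xs]]]; split=> //; rewrite fl_quotientsS xc xs.
Qed.

(** Either side forces |x| = rho^(-i): on the left because 1/x is within 1 of c, on the right
    because x is close to 1/(c + y). Then x - 1/(c + y) = - x (c + y)^(-1) (1/x - c - y) shows that
    distances scale exactly by rho^(-2i). *)
Lemma branch_cball (c y : K) (i n : nat) : fl c = c -> absK c = rho ^+ i -> (0 < i)%N ->
  B y -> B `&` [set x : K | fl x^-1 = c /\ cball y n (fl_map x)]
    = cball (c + y)^-1 (n + i.*2).
Proof.
move=> flc ci i0 By.
have ri : 1 < rho ^+ i by rewrite exprn_egt1// -lt0n.
have cy : absK (c + y) = rho ^+ i.
  rewrite -ci; apply: (absv_dominant av na).
  by rewrite addrAC subrr add0r ci; exact: lt_trans By ri.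
have cy0 : c + y != 0 by rewrite -(absv_gt0 av) cy.
have key (x : K) : x != 0 -> absK x = rho ^- i ->
    absK (x - (c + y)^-1) = absK (x^-1 - c - y) * rho ^- i.*2.
  move=> x0 xi; have -> : x - (c + y)^-1 = - (x * (c + y)^-1 * (x^-1 - c - y)).
    by field; rewrite cy0 x0.
  rewrite (absvN av) !(absvM av) (absvV av) cy xi -addnn exprD invfM.
  by rewrite mulrC.
apply/seteqP; split=> x.
  move=> [Bx [xc]]; rewrite /cball/=.
  (* Since 0^-1 = 0, the point 0 would have the digit [fl 0], of absolute value below 1, whereas |c|
     > 1. *)
  have x0 : x != 0.
    apply/eqP => x0; have := fl_lt1 x^-1.
    by rewrite xc x0 invr0 sub0r (absvN av) ci ltNge (ltW ri).
  have xi : absK x = rho ^- i.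
    rewrite -[x]invrK (absvV av) -ci -xc; congr _^-1; apply: (absv_dominant av na).
    by apply: lt_trans (fl_lt1 _) _; rewrite xc ci.
  rewrite /fl_map (negbTE x0) xc key// exprD invfM => h.
  by rewrite ltr_pM2r// invr_gt0.
rewrite /cball/= => xy.
have n2 : rho ^- (n + i.*2) < rho ^- i.
  by rewrite ltf_pV2 ?posrE// ltr_eXn2l// -addnn addnCA -{1}(addn0 i) ltn_add2l; lia.
have xi : absK x = rho ^- i.
  rewrite -cy -(absvV av); apply: (absv_dominant av na).
  by rewrite (absvV av) cy; exact: lt_trans xy n2.
have x0 : x != 0 by rewrite -(absv_gt0 av) xi invr_gt0.
have Bx : B x by rewrite /unit_ball/= xi invf_lt1.
have h : absK (x^-1 - c - y) < rho ^- n.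
  by move: xy; rewrite key// exprD invfM ltr_pM2r// invr_gt0.
have xc : fl x^-1 = c.
  rewrite -flc; apply: fl_eq; rewrite -(subrK y (x^-1 - c)).
  apply: (absv_ultra_lt av na) => //; apply: lt_le_trans h _.
  by rewrite invf_le1// exprn_ege1// ltW.
by split=> //; split=> //; rewrite /fl_map (negbTE x0) xc.
Qed.

(* The digits c with |c| > 1 and fl c = c index the full branches of the map;
   a cylinder that involves any other digit has at most one point. *)
Let digit_cases (c : K) :
  (exists i : nat, [/\ fl c = c, absK c = rho ^+ i & (0 < i)%N]) \/
  (forall x : K, B x -> fl x^-1 = c -> x = 0).
Proof.
have [h|no] := pselect (exists i : nat, [/\ fl c = c, absK c = rho ^+ i & (0 < i)%N]).
  by left.
right=> x Bx xc; apply/eqP/negPn/negP => x0; apply: no.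
have x1 : 1 < absK x^-1 by rewrite (absvV av) invf_gt1// (absv_gt0 av).
have cx : absK x^-1 = absK c.
  apply/esym/(absv_dominant av na); rewrite -xc (absvB av).
  exact: lt_trans (fl_lt1 _) x1.
have c0 : c != 0 by rewrite -(absv_gt0 av) -cx (lt_trans _ x1).
have [z cz] := absE c0; have z0 : 0 < z.
  by rewrite -(ltr_eXz2l rho_gt1) expr0z -cz -cx.
exists `|z|%N; split.
- by rewrite -[in RHS]xc; apply: fl_eq; rewrite -xc (absvB av).
- by rewrite cz exprnP gtz0_abs.
- by rewrite absz_gt0 gt_eqF.
Qed.

(** On a branch, the digit and the image determine the point: 1/x = c + [fl_map x]. *)
Let branch_inj (c : K) (S : set (borel_space absK)) : subsingleton S ->
  subsingleton (B `&` [set x : K | fl x^-1 = c /\ S (fl_map x)]).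
Proof.
move=> S1 x x' [Bx [xc Sx]] [Bx' [xc' Sx']].
have [[i [flc ci i0]]|h] := digit_cases c; last by rewrite (h x Bx xc) (h x' Bx' xc').
have ne0 (z : K) : fl z^-1 = c -> z != 0.
  move=> zc; apply/eqP => z0; have := fl_lt1 z^-1.
  by rewrite zc z0 invr0 sub0r (absvN av) ci ltNge exprn_ege1// ltW.
have := S1 _ _ Sx Sx'; rewrite /fl_map (negbTE (ne0 _ xc)) (negbTE (ne0 _ xc')) xc xc'.
by move=> /addIr/invr_inj.
Qed.

Let cylinder_nil : cylinder [::] = cball 0 0.
Proof. by rewrite cball0; apply/seteqP; split=> x; [case | split]. Qed.

Let cylinder_cases (s : seq K) :
  (exists y n, B y /\ cylinder s = cball y n) \/ subsingleton (cylinder s).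
Proof.
elim: s => [|c s [[y [n [By sE]]]|S1]].
- left; exists 0, 0%N; split; last exact: cylinder_nil.
  by rewrite /unit_ball/= (absv0 av).
- have [[i [flc ci i0]]|h] := digit_cases c.
    left; exists (c + y)^-1, (n + i.*2)%N; rewrite cylinder_cons sE (branch_cball _ flc ci i0 By).
    split=> //; rewrite /unit_ball/= (absvV av) invf_lt1.
      rewrite (@absv_dominant _ _ _ av na _ c) ?ci ?exprn_egt1 -?lt0n//.
      by rewrite addrAC subrr add0r (lt_trans By)// exprn_egt1// -lt0n.
    rewrite (@absv_dominant _ _ _ av na _ c) ?ci//.
    by rewrite addrAC subrr add0r (lt_trans By)// exprn_egt1// -lt0n.
  right=> x x'; rewrite cylinder_cons => -[Bx [xc _]] [Bx' [xc' _]].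
  by rewrite (h x Bx xc) (h x' Bx' xc').
- by right; rewrite cylinder_cons; exact: branch_inj.
Qed.

Lemma measurable_cylinder s : measurable (cylinder s).
Proof.
have [[y [n [_ ->]]]|/subsingletonP[]//] := cylinder_cases s.
exact: measurable_cball.
Qed.

(** The branch of c raises the index of every ball by the same 2i. It thus multiplies all measures
    by q^(-2i), which is the measure of the cylinder of c itself. *)
Lemma mu_cylinder_cons c s :
  mu (cylinder (c :: s)) = (mu (cylinder [:: c]) * mu (cylinder s))%E.
Proof.
have [[i [flc ci i0]]|h] := digit_cases c; last first.
  have h0 t : mu (cylinder (c :: t)) = 0%E.
    apply: (subsingletonP _).2 => x x'.
    rewrite cylinder_cons => -[Bx [xc _]] [Bx' [xc' _]].
    by rewrite (h x Bx xc) (h x' Bx' xc').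
  by rewrite !h0 mul0e.
have B0 : B 0 by rewrite /unit_ball/= (absv0 av).
rewrite !cylinder_cons cylinder_nil (branch_cball _ flc ci i0 B0) mu_cball.
have [[y [n [By ->]]]|S1] := cylinder_cases s.
  by rewrite (branch_cball _ flc ci i0 By) !mu_cball -EFinM exprD invfM mulrC.
by rewrite (subsingletonP S1).2 mule0 (subsingletonP (branch_inj S1)).2.
Qed.

Lemma mu_cylinder_cat s t :
  mu (cylinder (s ++ t)) = (mu (cylinder s) * mu (cylinder t))%E.
Proof.
elim: s => [|c s ih] /=; first by rewrite cylinder_nil mu_cball expr0 invr1 mul1e.
by rewrite mu_cylinder_cons [in RHS]mu_cylinder_cons ih muleA.
Qed.

Lemma fl_quotients_fiber n s :
  B `&` fl_quotients n @^-1` [set s] = if size s == n then cylinder s else set0.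
Proof.
case: eqP => [<-//|sn]; apply/seteqP; split=> // x [_ /= xs].
by apply: sn; rewrite -xs size_mkseq.
Qed.

Lemma discrete_fl_quotients n : discrete_on B (fl_quotients n).
Proof.
split; last first.
  move=> s; rewrite fl_quotients_fiber; case: eqP => _.
    exact: measurable_cylinder.
  exact: measurable0.
suff [A cA hA] : exists2 A, countable A & forall x, A (fl_quotients n x).
  by exists A.
elim: n => [|n [A cA hA]]; first by exists [set [::]].
exists ((fun cs => cs.1 :: cs.2) @` (range fl `*` A)).
  apply: (sub_countable (card_image_le _ _)); exact: countableX.
move=> x; rewrite fl_quotientsS.
by exists (fl (x : K)^-1, fl_quotients n (fl_map x)) => //; split; [exact: imageT | exact: hA].
Qed.

Lemma discrete_fl_quotients_iter m n :
  discrete_on B (fun x => fl_quotients n (iter m fl_map x)).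
Proof.
have -> : (fun x => fl_quotients n (iter m fl_map x)) = drop m \o fl_quotients (m + n).
  apply/funext => x /=; rewrite fl_quotientsD drop_size_cat//.
  by rewrite size_mkseq.
exact: (discrete_comp (drop m) (discrete_fl_quotients (m + n))).
Qed.

(** Multiplicativity of cylinder measures under concatenation says that the first m quotients are
    independent of the next n, and that these are distributed like the first n. With g = 1 this is
    stationarity. *)
Lemma fl_quotients_independent m n (g h : seq K -> \bar R) :
  (forall s, (0 <= g s)%E) -> (forall s, (0 <= h s)%E) ->
  (\int[mu]_(x in B) (g (fl_quotients m x) * h (fl_quotients n (iter m fl_map x))) =
   \int[mu]_(x in B) g (fl_quotients m x) * \int[mu]_(x in B) h (fl_quotients n x))%E.
Proof.
move=> g0 h0; apply: (independent_integral measurable_unit_ball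
  (Y := fun x => fl_quotients n (iter m fl_map x))) => //.
- exact: discrete_fl_quotients.
- exact: discrete_fl_quotients_iter.
- exact: discrete_fl_quotients.
move=> s t; rewrite !fl_quotients_fiber.
have [sm|sm] := eqVneq (size s) m; last first.
  rewrite measure0 mul0e (_ : _ `&` _ = set0) ?measure0//.
  by apply/seteqP; split=> // x [_ [xs _]]; move: sm; rewrite -xs size_mkseq eqxx.
have [tn|tn] := eqVneq (size t) n; last first.
  rewrite measure0 mule0 (_ : _ `&` _ = set0) ?measure0//.
  by apply/seteqP; split=> // x [_ [_ xt]]; move: tn; rewrite -xt size_mkseq eqxx.
rewrite -mu_cylinder_cat; congr (mu _); apply/seteqP; split=> x; rewrite /cylinder/=.
  by move=> [Bx [<- <-]]; split=> //; rewrite size_cat !size_mkseq fl_quotientsD.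
rewrite size_cat sm tn fl_quotientsD => -[Bx /eqP].
by rewrite eqseq_cat ?size_mkseq ?sm// => /andP[/eqP -> /eqP ->].
Qed.

Lemma fl_quotients_stationary m n (h : seq K -> \bar R) : (forall s, (0 <= h s)%E) ->
  (\int[mu]_(x in B) h (fl_quotients n (iter m fl_map x)) =
   \int[mu]_(x in B) h (fl_quotients n x))%E.
Proof.
move=> h0; have := @fl_quotients_independent m n (fun=> 1%E) h (fun=> lee01) h0.
rewrite [X in _ = (X * _)%E]integral_cst// mu_ball1 !mul1e => <-.
by apply: eq_integral => x _; rewrite mul1e.
Qed.

(* The value 0 is junk: it is taken when |c| <= 1. *)
Definition abs_exponent (c : K) : nat :=
  xget 0%N [set i : nat | (0 < i)%N /\ absK c = rho ^+ i].

Lemma abs_exponentE (c : K) (i : nat) : (0 < i)%N -> absK c = rho ^+ i ->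
  abs_exponent c = i.
Proof.
move=> i0 ci; rewrite /abs_exponent; case: xgetP => [j _ /= [_]|/(_ i)]; last by case.
by rewrite ci => h; apply/esym/(ieexprIn rho_gt0 (negbT (gt_eqF rho_gt1))).
Qed.

(** The law of the exponent of a quotient. Weight 0 at the junk exponent lets the product formula
    hold for all lists of naturals. *)
Definition exponent_weight (i : nat) : R :=
  if i == 0%N then 0 else (q - 1)%:R / q%:R ^+ i.

Lemma mu_abs_exponent (i : nat) :
  mu (B `&` [set x : K | abs_exponent (fl x^-1) = i]) = (exponent_weight i)%:E.
Proof.
rewrite /exponent_weight; case: (posnP i) => [->|i0] /=.
  apply: (subsingletonP _).2.
  suff h (x : K) : B x -> abs_exponent (fl x^-1) = 0%N -> x = 0.
    by move=> x x' [Bx xi] [Bx' xi']; rewrite (h x Bx xi) (h x' Bx' xi').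
  move=> Bx; have [[j [_ cj j0]]|/(_ x Bx erefl)//] := digit_cases (fl x^-1).
  by rewrite (abs_exponentE j0 cj) => jz; move: j0; rewrite jz.
have ri j : 0 < rho ^- j by rewrite invr_gt0.
have fl_abs (x : K) : B x -> x != 0 -> absK (fl x^-1) = (absK x)^-1.
  move=> Bx x0; rewrite -(absvV av); apply: (absv_dominant av na); rewrite (absvB av).
  apply: lt_trans (fl_lt1 _) _.
  by rewrite (absvV av) invf_gt1// (absv_gt0 av).
(* The event is the sphere |x| = rho^(-i). The balls are open, hence the index i - 1 for the ball
   that contains it. *)
have -> : B `&` [set x : K | abs_exponent (fl x^-1) = i] = cball 0 i.-1 `\` cball 0 i.
  apply/seteqP; split=> x; rewrite /cball/= !subr0.
    move=> [Bx xi].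
    have x0 : x != 0.
      apply/eqP => x0; move: i0; rewrite -xi /abs_exponent; case: xgetP => [j _ /= [j0 fj] _|//].
      have := fl_lt1 x^-1; rewrite x0 invr0 sub0r (absvN av).
      by move: fj; rewrite x0 invr0 => ->; rewrite ltNge exprn_ege1// ltW.
    move: i0; rewrite -xi /abs_exponent; case: xgetP => [j _ /= [j0 fj] _|//].
    move: fj; rewrite fl_abs// => /(congr1 GRing.inv); rewrite invrK => ->.
    by rewrite ltxx; split=> //; rewrite ltf_pV2 ?posrE// ltr_eXn2l// prednK.
  move=> [x1 x2].
  have Bx : B x by rewrite -cball0 /cball/= subr0; exact: lt_le_trans x1 (rhoN_le (leq0n _)).
  have x0 : x != 0.
    by apply/eqP => x0; apply: x2; rewrite x0 (absv0 av).
  split=> //; apply: abs_exponentE => //; rewrite fl_abs//.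
  have /eqP -> : absK x == rho ^- i.
    rewrite eq_le; apply/andP; split; last by rewrite leNgt; apply/negP.
    by have := absK_ltX x1; rewrite prednK.
  by rewrite invrK.
have fin : (mu (cball 0 i.-1) < +oo)%E by rewrite mu_cball ltry.
rewrite (measureD (measurable_cball 0 i.-1) (measurable_cball 0 i) fin).
rewrite (_ : _ `&` _ = cball 0 i); last first.
  apply/setIidr => x; rewrite /cball/= => /lt_le_trans; apply.
  by apply: rhoN_le; exact: leq_pred.
rewrite -[LHS]/(mu (cball 0 i.-1) - mu (cball 0 i))%E !mu_cball -EFinB; congr EFin.
have -> : q%:R ^+ i = q%:R * q%:R ^+ i.-1 :> R by rewrite -exprS prednK.
rewrite natrB ?(ltnW q_gt1)//.
by field; rewrite expf_neq0 !gt_eqF.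
Qed.

Let exponents n (x : borel_space absK) := map abs_exponent (fl_quotients n x).

Lemma mu_abs_exponents (v : seq nat) :
  mu (B `&` [set x | exponents (size v) x = v]) = (\prod_(i <- v) exponent_weight i)%:E.
Proof.
elim: v => [|i v ih].
  rewrite big_nil (_ : _ `&` _ = B) ?mu_ball1//; exact/setIidl.
pose b1 (s : seq K) := map abs_exponent s == [:: i].
pose b2 (s : seq K) := map abs_exponent s == v.
have := @fl_quotients_independent 1 (size v) (fun s => ((b1 s)%:R)%:E) (fun s => ((b2 s)%:R)%:E).
rewrite (discrete_integral_pred mu measurable_unit_ball b1 (discrete_fl_quotients 1)).
rewrite (discrete_integral_pred mu measurable_unit_ball b2 (discrete_fl_quotients (size v))).
have -> : B `&` fl_quotients 1 @^-1` [set s | b1 s]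
    = B `&` [set x : K | abs_exponent (fl x^-1) = i].
  apply/seteqP; split=> x [Bx]; rewrite /b1 => h; split=> //.
      by case/eqP: h.
    by apply/eqP; congr [:: _].
have -> : B `&` fl_quotients (size v) @^-1` [set s | b2 s]
    = B `&` [set x | exponents (size v) x = v].
  by apply/seteqP; split=> x [Bx]; rewrite /b2/= => /eqP.
rewrite mu_abs_exponent ih big_cons EFinM => <- //.
pose b (s : seq K) := map abs_exponent s == i :: v.
transitivity (\int[mu]_(x in B) ((b (fl_quotients (size v).+1 x))%:R)%:E)%E.
  rewrite (discrete_integral_pred mu measurable_unit_ball b (discrete_fl_quotients _)).
  congr (mu _).
  by apply/seteqP; split=> x [Bx]; rewrite /b/= => /eqP.
apply: eq_integral => x _; rewrite /b fl_quotientsS /= -EFinM -natrM mulnb.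
by rewrite /b1 /b2 /fl_quotients/= eqseq_cons !eqseq_cons andbT.
Qed.

(** Removes the words for which replacing |c| by [rho ^+ abs_exponent c] would be wrong. *)
Let exponent_junk (s : seq K) (c : K) : c \in s -> absK c != rho ^+ abs_exponent c ->
  mu (cylinder s) = 0%E.
Proof.
move=> /splitPr[s1 s2] cj; rewrite mu_cylinder_cat mu_cylinder_cons.
suff -> : mu (cylinder [:: c]) = 0%E by rewrite mul0e mule0.
apply: (subsingletonP _).2 => x x'; rewrite !cylinder_cons => -[Bx [xc _]] [Bx' [xc' _]].
have [[i [_ ci i0]]|h] := digit_cases c; last by rewrite (h x Bx xc) (h x' Bx' xc').
by move: cj; rewrite (abs_exponentE i0 ci) ci eqxx.
Qed.

Lemma abs_quotients_integral (k : nat) (phi : ('I_k -> R) -> \bar R) :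
  (forall t, (0 <= phi t)%E) ->
  (\int[mu]_(x in B) phi (fun l => absK (nth 0%R (fl_quotients k x) l)) =
   \esum_(v in [set v : {ffun 'I_k -> nat} | forall l, (0 < v l)%N])
     (phi (fun l => (rho ^+ v l)%R) * (\prod_(l < k) ((q - 1)%:R / q%:R ^+ v l))%R%:E))%E.
Proof.
move=> phi0.
pose ex (s : seq K) : {ffun 'I_k -> nat} := [ffun l : 'I_k => abs_exponent (nth 0 s l)].
transitivity (\int[mu]_(x in B) phi (fun l => (rho ^+ ex (fl_quotients k x) l)%R))%E.
  rewrite (discrete_integral (g := fun s => phi (fun l => absK (nth 0 s l)))
    mu (discrete_fl_quotients k) (fun=> phi0 _)).
  rewrite (discrete_integral (g := fun s => phi (fun l => rho ^+ ex s l))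
    mu (discrete_fl_quotients k) (fun=> phi0 _)).
  apply: eq_esum => s _; rewrite fl_quotients_fiber.
  case: eqP => [sk|]; last by rewrite measure0 !mule0.
  have [/allP h|/allPn[c cs cj]] := boolP (all (fun c => absK c == rho ^+ abs_exponent c) s).
    congr (phi _ * _)%E; apply/funext => l; rewrite ffunE; apply/eqP/h.
    by rewrite mem_nth// sk.
  by rewrite (exponent_junk cs cj) !mule0.
rewrite (discrete_integral (g := fun v : {ffun 'I_k -> nat} => phi (fun l => rho ^+ v l))
    mu (discrete_comp ex (discrete_fl_quotients k)) (fun=> phi0 _)).
rewrite [RHS]esum_mkcond; apply: eq_esum => v _.
have -> : B `&` (ex \o fl_quotients k) @^-1` [set v] =
    B `&` [set x | exponents (size [seq v l | l <- enum 'I_k]) x = [seq v l | l <- enum 'I_k]].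
  have sk : size [seq v l | l <- enum 'I_k] = k by rewrite size_map size_enum_ord.
  rewrite sk; apply/seteqP; split=> x [Bx] /= h; split=> //=.
    apply: (@eq_from_nth _ 0%N); rewrite ?sk /exponents size_map size_mkseq// => j jk.
    rewrite (nth_map 0) ?size_mkseq// (nth_map (Ordinal jk)) ?size_enum_ord//.
    by rewrite -h ffunE nth_enum_ord.
  apply/ffunP => l; rewrite ffunE; have := congr1 (fun s => nth 0%N s l) h.
  by rewrite /exponents (nth_map 0) ?size_mkseq// (nth_map l) ?size_enum_ord// nth_ord_enum.
rewrite mu_abs_exponents big_map big_enum/=.
case: ifPn => [|/negP vn]; rewrite ?inE/=.
  move=> v0; congr (_ * _%:E)%E; apply: eq_bigr => l _.
  by rewrite /exponent_weight gtn_eqF.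
(* The sum was extended to all exponent vectors; one with a zero entry has weight 0. *)
have [l vl] : exists l, v l = 0%N.
  apply: contrapT => no; apply: vn; rewrite inE => l; rewrite lt0n; apply/eqP => vl.
  by apply: no; exists l.
by rewrite (bigD1 l)//= vl mul0r mule0.
Qed.

(** The domination by |H| lets the single moment hypothesis on [H] serve for |H| and for both parts
    of [H]. *)
Lemma quotients_moving_average (k : nat) (phi H : ('I_k -> R) -> R) (a b : nat -> nat) :
  (forall t, 0 <= phi t <= `|H t|) ->
  (\int[mu]_(x in B) (`|H (fun l => absK (nth 0%R (fl_quotients k x) l))| ^+ 2)%:E < +oo)%E ->
  stoltz R a b ->
  exists M : R,
    (\esum_(v in [set v : {ffun 'I_k -> nat} | forall l, (0 < v l)%N])
       (phi (fun l => (rho ^+ v l)%R) *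
          \prod_(l < k) ((q - 1)%:R / q%:R ^+ v l))%:E = M%:E)%E /\
    {ae mu, forall x, B x ->
      (fun n => (b n)%:R^-1 * \sum_(a n <= j < a n + b n)
         phi (fun l => absK (fl (iter (j + l) fl_map (x : K))^-1))) @ \oo --> M}.
Proof.
move=> phiH Hfin stab.
have phi0 t : 0 <= phi t by case/andP: (phiH t).
pose psi (s : seq K) : R := phi (fun l => absK (nth 0 s l)).
pose y j (x : borel_space absK) : R := psi (fl_quotients k (iter j fl_map (x : K))).
have yE j x : y j x = phi (fun l => absK (fl (iter (j + l) fl_map (x : K))^-1)).
  by rewrite /y /psi; congr phi; apply/funext => l; rewrite nth_mkseq// addnC iterD.
have psi0 s : 0 <= psi s by exact: phi0.
have y0 j x : 0 <= y j x by exact: psi0.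
have my j : measurable_fun B (y j).
  exact: (discrete_measurable_fun psi (discrete_fl_quotients_iter j k)).
have myE (g : R -> R) : measurable_fun B (fun x => ((g (y 0%N x))%:E : \bar R)).
  exact: (discrete_measurable_fun (fun s => (g (psi s))%:E) (discrete_fl_quotients k)).
have V_fin : (\int[mu]_(x in B) (y 0%N x ^+ 2)%:E < +oo)%E.
  apply: le_lt_trans Hfin; apply: ge0_le_integral => //.
  - by move=> x _; rewrite lee_fin sqr_ge0.
  - exact: (myE (fun r => r ^+ 2)).
  - exact: (discrete_measurable_fun
      (fun s => (`|H (fun l => absK (nth 0 s l))| ^+ 2)%:E) (discrete_fl_quotients k)).
  - move=> x _; rewrite lee_fin lerXn2r ?nnegrE//.
    by case/andP: (phiH (fun l => absK (nth 0 (fl_quotients k x) l))).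
have M_fin : (\int[mu]_(x in B) (y 0%N x)%:E < +oo)%E.
  (* The unit ball has measure 1, so y <= 1 + y^2 bounds the mean by the second moment. *)
  apply: (@le_lt_trans _ _ (\int[mu]_(x in B) (1%:E + (y 0%N x ^+ 2)%:E))%E).
    apply: ge0_le_integral => //.
    - by move=> x _; rewrite lee_fin.
    - exact: (myE id).
    - exact: (myE (fun r => 1 + r ^+ 2)).
    - by move=> x _; rewrite -EFinD lee_fin; have := sqr_ge0 (y 0%N x - 1); nra.
  rewrite ge0_integralD//; last 2 first.
  - by move=> x _; rewrite lee_fin sqr_ge0.
  - exact: (myE (fun r => r ^+ 2)).
  rewrite [X in (X + _)%E](integral_cst mu measurable_unit_ball 1%E) mu_ball1 mule1.
  by rewrite lte_add_pinfty// ltry.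
have real_of (z : \bar R) : (0 <= z)%E -> (z < +oo)%E -> exists r, z = r%:E.
  by move=> z0 zoo; exists (fine z); rewrite fineK// ge0_fin_numE.
have [M EM] := real_of _ (integral_ge0 _
  (fun x _ => y0 0%N x : (0 <= (y 0%N x)%:E)%E)) M_fin.
have [V EV] := real_of _ (integral_ge0 _
  (fun x _ => sqr_ge0 (y 0%N x) : (0 <= (y 0%N x ^+ 2)%:E)%E)) V_fin.
have y_mean j : (\int[mu]_(x in B) (y j x)%:E = M%:E)%E.
  rewrite -EM; exact: (fl_quotients_stationary j k (h := fun s => (psi s)%:E)).
have y_mom j : (\int[mu]_(x in B) (y j x ^+ 2)%:E = V%:E)%E.
  rewrite -EV; apply: (fl_quotients_stationary j k (h := fun s => (psi s ^+ 2)%:E)) => s.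
  by rewrite lee_fin sqr_ge0.
have y_unc i j : (i + k <= j)%N ->
    (\int[mu]_(x in B) (y i x * y j x)%:E = (M ^+ 2)%:E)%E.
  move=> ikj; have kij : (k <= j - i)%N by lia.
  (* [psi] reads only k entries. Viewed as a function of j - i >= k quotients, the earlier factor
     uses a block adjacent to that of the later one, as the product formula requires. *)
  have headE (x : K) : psi (fl_quotients (j - i) x) = psi (fl_quotients k x).
    rewrite /psi; congr phi; apply/funext => l.
    by rewrite !nth_mkseq//; exact: leq_trans (ltn_ord l) kij.
  pose h (s : seq K) : \bar R := (psi (take (j - i) s) * psi (drop (j - i) s))%:E.
  have hE (x : K) : h (fl_quotients (j - i + k) x) =
      ((psi (fl_quotients (j - i) x))%:E * (psi (fl_quotients k (iter (j - i) fl_map x)))%:E)%E.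
    by rewrite /h fl_quotientsD take_size_cat ?drop_size_cat ?size_mkseq.
  transitivity (\int[mu]_(x in B) h (fl_quotients (j - i + k) (iter i fl_map (x : K))))%E.
    apply: eq_integral => x _; rewrite hE headE -iterD subnK ?EFinM//; lia.
  rewrite (fl_quotients_stationary i (j - i + k) (h := h)); last first.
    by move=> s; rewrite lee_fin mulr_ge0.
  under eq_integral do rewrite hE.
  rewrite (@fl_quotients_independent (j - i) k (fun s => (psi s)%:E) (fun s => (psi s)%:E))//.
  under eq_integral do rewrite headE.
  by rewrite (_ : (\int[mu]_(x in B) _ = M%:E)%E) ?expr2 ?EFinM.
exists M; split.
  rewrite -EM -(@abs_quotients_integral k (fun t => (phi t)%:E))//.
have := moving_average measurable_unit_ball mu_ball1 y0 my y_mean y_mom y_unc stab.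
by apply: filterS => x + Bx => /(_ Bx); under eq_fun do under eq_bigr do rewrite yE.
Qed.

End Cylinders.

(** * Moving averages of partial quotients *)

Lemma partial_quotients_moving_average (R : realType) (p : nat) (Qp : fieldType)
    (absp : Qp -> R) (K : fieldExtType Qp) (absK : K -> R) (e f : nat) (gamma beta : K)
    (mu : {measure set (borel_space absK) -> \bar R})
    (k : nat) (phi H : ('I_k -> R) -> R) (a b : nat -> nat)
    (c := partial_quotient p absp e f gamma beta) :
  prime p -> is_padic_field p absp -> absolute_value absK ->
  (forall x : Qp, absK (x%:A) = absp x) ->
  ramification_index absp absK fullv e -> residue_degree absp absK fullv f ->
  (p ^ f - 1)%N.-primitive_root gamma -> absK beta = p%:R `^ (e%:R^-1) ->
  haar_measure mu -> mu (unit_ball absK) = 1%E ->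
  (forall t, 0 <= phi t <= `|H t|) ->
  (\int[mu]_(x in unit_ball absK)
     ((`|H (fun i : 'I_k => absK (c i.+1 x))| ^+ 2)%:E) < +oo)%E ->
  stoltz R a b ->
  exists M : R,
    (\esum_(i in [set i : {ffun 'I_k -> nat} | forall l, (0 < i l)%N])
       (phi (fun l => p%:R `^ ((i l)%:R / e%:R)) *
          (((p ^ f - 1) ^ k)%:R / (p ^ (f * \sum_(l < k) i l))%:R))%R%:E = M%:E)%E /\
    {ae mu, forall x, unit_ball absK x ->
      (fun n : nat => (b n)%:R^-1 * \sum_(1 <= j < (b n).+1)
         phi (fun i : 'I_k => absK (c (a n + j + i)%N x))) @ \oo --> M}.
Proof.
move=> p_prime pf avK ext ram res prim absb haar mu1 phiH Hfin stab.
pose fl := cf_floor p absp e f gamma beta.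
pose digits := [seq gamma_digits gamma t | t <- enum {ffun 'I_f -> 'I_p}].
(* The default 0 keeps |digit n| <= 1 valid beyond the p^f actual representatives. *)
pose digit n := nth 0 digits n.
have naK := absK_nat_le1 p_prime pf ext.
have rho_gt1 := uniformizer_gt1 p_prime ram.
have card_digits : size (enum {ffun 'I_f -> 'I_p}) = (p ^ f)%N.
  by rewrite -cardE card_ffun !card_ord.
have digitE n : (n < p ^ f)%N ->
    exists2 t, nth t (enum {ffun 'I_f -> 'I_p}) n = t & digit n = gamma_digits gamma t.
  move=> nq; have t0 : {ffun 'I_f -> 'I_p} := [ffun=> Ordinal (prime_gt0 p_prime)].
  exists (nth t0 (enum {ffun 'I_f -> 'I_p}) n).
    by apply: set_nth_default; rewrite card_digits.
  by rewrite /digit /digits (nth_map t0)// card_digits.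
have digit_inj i j : (i < p ^ f)%N -> (j < p ^ f)%N ->
    absK (digit i - digit j) < 1 -> i = j.
  move=> iq jq; have [t ti ->] := digitE _ iq; have [t' tj ->] := digitE _ jq.
  move=> /(gamma_digits_inj p_prime pf avK ext ram prim) tt.
  apply/eqP; rewrite -(nth_uniq t _ _ (enum_uniq {ffun 'I_f -> 'I_p})) ?card_digits//.
  by rewrite ti {1}tt; rewrite -tt in tj; rewrite tj tt.
have digit_le1 i : absK (digit i) <= 1.
  have [iq|qi] := ltnP i (p ^ f); last first.
    by rewrite /digit nth_default ?(absv0 avK)// size_map card_digits.
  have [t _ ->] := digitE _ iq.
  apply: (absv_sum_le avK naK) => // j _.
  rewrite (absK_scale avK ext) (abs_gammaX avK prim) mulr1.
  exact: (padic_abs_nat_le1 p_prime pf).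
have digit_ex x : absK x <= 1 -> exists2 i, (i < p ^ f)%N & absK (x - digit i) < 1.
  move=> /(gamma_digits_residue p_prime pf avK ext ram res prim)[t xt].
  have tq : (index t (enum {ffun 'I_f -> 'I_p}) < p ^ f)%N.
    by rewrite -card_digits index_mem mem_enum.
  exists (index t (enum {ffun 'I_f -> 'I_p})) => //.
  by rewrite /digit /digits (nth_map t) ?card_digits// nth_index ?mem_enum.
(* As |beta| > 1, it is the inverse of beta that serves as uniformizer. *)
have abs_varpi : absK beta^-1 = (p%:R `^ (e%:R^-1))^-1 by rewrite (absvV avK) absb.
have q_gt1 : (1 < p ^ f)%N.
  by have := prim_order_gt0 prim; rewrite subn_gt0.
have cE x j : c j.+1 x = fl (iter j (fl_map fl) x)^-1 by [].
have {}Hfin : (\int[mu]_(x in unit_ball absK)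
    (`|H (fun l => absK (nth 0%R (fl_quotients fl k x) l))| ^+ 2)%:E < +oo)%E.
  apply: le_lt_trans Hfin; rewrite le_eqVlt; apply/orP; left; apply/eqP.
  apply: eq_integral => x _; congr (`|H _| ^+ 2)%:E; apply/funext => l.
  by rewrite nth_mkseq// cE.
have [M [EM ae]] := quotients_moving_average avK naK rho_gt1
  (@absKE _ _ _ _ _ _ _ _ p_prime pf avK ram absb) abs_varpi q_gt1 digit_inj digit_le1 digit_ex
  (cf_floor_lt1 p_prime pf avK ext ram res prim absb)
  (@cf_floor_eq _ _ _ _ _ _ _ _ _ _ p_prime pf avK ext ram res prim absb)
  (countable_cf_floor e f gamma beta p_prime pf) haar mu1 phiH Hfin stab.
exists M; split.
  rewrite -EM; apply: eq_esum => i _; congr (phi _ * _)%:E.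
    apply/funext => l; rewrite mulrC powRrM powR_mulrn//; exact: powR_ge0.
  rewrite big_split/= prodr_const card_ord prodfV prodrXr natrX; congr (_ / _).
  by rewrite expnM natrX.
apply: filterS ae => x + Bx => /(_ Bx).
rewrite (_ : (fun n => _) = (fun n => (b n)%:R^-1 * \sum_(1 <= j < (b n).+1)
  phi (fun i : 'I_k => absK (c (a n + j + i)%N x))))//.
(* Quotients are numbered from 1 and iterates from 0, so the summation from 1 to b_n becomes the
   range of iterates a_n <= j < a_n + b_n. *)
apply/funext => n; congr (_ * _); rewrite -{1}[a n]add0n big_addn addKn big_add1/=.
apply: eq_bigr => j _; congr phi; apply/funext => l.
by rewrite addnS addSn cE [(a n + j)%N]addnC.
Qed.

Theorem proposition27 (R : realType) (p : nat) (Qp : fieldType)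
    (absp : Qp -> R) (K : fieldExtType Qp) (absK : K -> R) (e f : nat)
    (L : {subfield K}) (gamma beta : K)
    (mu : {measure set (borel_space absK) -> \bar R})
    (k : nat) (H : ('I_k -> R) -> R) (a b : nat -> nat)
    (c := partial_quotient p absp e f gamma beta)
    (F := fun i : {ffun 'I_k -> nat} =>
       H (fun l => p%:R `^ ((i l)%:R / e%:R)) *
       ((p ^ f - 1) ^ k)%:R / (p ^ (f * \sum_(l < k) i l))%:R)
    (Nk := [set i : {ffun 'I_k -> nat} | forall l, (0 < i l)%N]) :
  prime p ->
  is_padic_field p absp ->
  absolute_value absK ->
  (forall x : Qp, absK (x%:A) = absp x) ->
  ramification_index absp absK fullv e ->
  residue_degree absp absK fullv f ->
  unramified absp absK L ->
  \dim L = f ->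
  (p ^ f - 1)%N.-primitive_root gamma ->
  <<1; gamma>>%VS = L ->
  <<L; beta>>%VS = fullv ->
  absK beta = p%:R `^ (e%:R^-1) ->
  haar_measure mu ->
  mu (unit_ball absK) = 1%E ->
  (0 < k)%N ->
  (\int[mu]_(x in unit_ball absK)
     ((`|H (fun i : 'I_k => absK (c i.+1 x))| ^+ 2)%:E) < +oo)%E ->
  (forall n, (0 < n)%N -> (0 < a n)%N /\ (0 < b n)%N) ->
  stoltz R a b ->
  summable Nk (EFin \o F) /\
  {ae mu, forall x, unit_ball absK x ->
     (fun n : nat => (b n)%:R^-1 *
        \sum_(1 <= j < (b n).+1)
           H (fun i : 'I_k => absK (c (a n + j + i)%N x)))
     @ \oo --> real_sum Nk F}.
Proof.
move=> p_prime pf avK ext ram res _ _ prim _ _ absb haar mu1 _ Hfin _ stab.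
have avg phi (phiH : forall t, 0 <= phi t <= `|H t|) :=
  partial_quotients_moving_average p_prime pf avK ext ram res prim absb haar mu1 phiH Hfin stab.
pose w (i : {ffun 'I_k -> nat}) : R :=
  ((p ^ f - 1) ^ k)%:R / (p ^ (f * \sum_(l < k) i l))%:R.
have w0 i : 0 <= w i by rewrite divr_ge0.
have FE i : F i = H (fun l => p%:R `^ ((i l)%:R / e%:R)) * w i by rewrite /F /w mulrA.
(* The case of |H| is used for the finiteness of its sum, which is absolute summability; the
   positive and negative parts below provide the limit. *)
have [|M [EM _]] := avg (fun t => `|H t|); first by move=> t; rewrite normr_ge0 lexx.
have [|M1 [EM1 ae1]] := avg (fun t => Num.max (H t) 0).
  by move=> t; rewrite le_max lexx orbT ge_max ler_norm normr_ge0.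
have [|M2 [EM2 ae2]] := avg (fun t => Num.max (- H t) 0).
  by move=> t; rewrite le_max lexx orbT ge_max -normrN ler_norm normr_ge0.
have -> : real_sum Nk F = M1 - M2.
  rewrite /real_sum (_ : (\esum_(i in Nk) (EFin \o F)^\+ i)%E = M1%:E); last first.
    rewrite -EM1; apply: eq_esum => i _.
    by rewrite funeposE /= FE -EFin_max maxr_pMl// mul0r.
  rewrite (_ : (\esum_(i in Nk) (EFin \o F)^\- i)%E = M2%:E)//.
  rewrite -EM2; apply: eq_esum => i _.
  by rewrite funenegE /= FE -EFin_max maxr_pMl// mul0r mulNr.
split.
  rewrite /summable (_ : (\esum_(i in Nk) _)%E = M%:E) ?ltry//.
  rewrite -EM; apply: eq_esum => i _.
  by rewrite /= FE normrM (ger0_norm (w0 i)).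
apply: filterS2 ae1 ae2 => x h1 h2 Bx.
apply: cvg_trans (cvgB (h1 Bx) (h2 Bx)); apply: near_eq_cvg; near=> n.
rewrite -[LHS]mulrBr -sumrB; congr (_ * _); apply: eq_bigr => j _.
case: (leP (H _) 0) => h.
  by rewrite max_l ?oppr_ge0// sub0r opprK.
by rewrite max_r ?oppr_le0 ?(ltW h)// subr0.
Unshelve. all: by end_near. Qed.
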